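(* Let $\theta_0\in\,]0,\pi/2[$, $0<\alpha<1$, $c>0$, and let $I:[0,\infty)\to[0,1]$ be non-decreasing. Then the optimization problem (OP2) has at least one optimal solution.
   Context: Model 2 (stem with variable length and variable leaf density, parameterized by arc-length $t$). For $\theta\in[\theta_0,\pi/2]$ and $u\ge0$ let $$G(\theta,u)=\Big(1-\exp\Big\{\frac{-u}{\cos(\theta-\theta_0)}\Big\}\Big)\cos(\theta-\theta_0).$$ An admissible control is a pair of measurable functions $\theta:[0,\infty)\to[\theta_0,\pi/2]$ and $u:[0,\infty)\to[0,\infty)$ with $u\in L^1([0,\infty))$. Its state is $y(t)=\int_0^t\sin\theta(s)\,ds$ (height) and $z(t)=\int_t^\infty u(s)\,ds$. Problem (OP2), for a non-decreasing light intensity $I:[0,\infty)\to[0,1]$ and constants $0<\alpha<1$, $c>0$: maximize over admissible $(\theta,u)$ $$J(\theta,u)=\int_0^\infty\Big[I(y(t))\,G(\theta(t),u(t))-c\,z(t)^\alpha\Big]dt\in[-\infty,\infty).$$ An optimal solution is an admissible pair attaining the supremum. *)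

(* Defs.v *)
From mathcomp Require Import all_boot all_order all_algebra.
From mathcomp Require Import all_classical all_reals all_analysis.
Set Implicit Arguments. Unset Strict Implicit. Unset Printing Implicit Defensive.
Import Order.TTheory GRing.Theory Num.Theory.
Local Open Scope classical_set_scope.
Local Open Scope ring_scope.

Section OP2.
Variable R : realType.

Definition halfline : set R := `[0, +oo[%classic.

Definition Gfun (theta0 th u : R) : R :=
  (1 - expR (- u / cos (th - theta0))) * cos (th - theta0).

Definition admissible (theta0 : R) (th u : R -> R) : Prop :=
  [/\ measurable_fun halfline th,
      (forall t, 0 <= t -> theta0 <= th t <= pi / 2),
      (forall t, 0 <= t -> 0 <= u t) &
      (@lebesgue_measure R).-integrable halfline (EFin \o u)].

Definition height (th : R -> R) (t : R) : R :=
  Rintegral (@lebesgue_measure R) `[0, t] (fun s => sin (th s)).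

Definition zstate (u : R -> R) (t : R) : R :=
  Rintegral (@lebesgue_measure R) `[t, +oo[ u.

Definition Jfun (theta0 alpha c : R) (I : R -> R) (th u : R -> R) : \bar R :=
  (\int[(@lebesgue_measure R)]_(t in halfline)
     (I (height th t) * Gfun theta0 (th t) (u t) - c * (zstate u t) `^ alpha)%:E)%E.

Definition optimal (theta0 alpha c : R) (I : R -> R) (th u : R -> R) : Prop :=
  admissible theta0 th u /\
  forall th' u', admissible theta0 th' u' ->
    (Jfun theta0 alpha c I th' u' <= Jfun theta0 alpha c I th u)%E.

End OP2.

(* Main.v *)
(* With p = sin th the gain rate becomes a jointly concave function
   of (p, u), for cos (th - th0) is concave in p on the range of controls and
   w (1 - exp (- u / w)) is jointly concave and nondecreasing in w.  Compactness
   comes from an a priori envelope.  A nonnegative payoff bounds the integral of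
   z^alpha, hence z(t)^alpha <= M / t, uniformly.  One unit of leaf at height
   parameter s then costs at least a constant times s^(1/alpha), while the part
   of u above a level phi gains at most exp (- phi) per unit; so cutting u at
   phi(s) = (1/alpha) log^+ (T/s), an integrable function, never decreases the
   payoff.

   For controls below phi take a maximizing sequence.  By Helly's theorem the
   heights y_k and the masses z_k converge almost everywhere along a
   subsequence; as the limit height is strictly increasing, I(y_k) converges
   almost everywhere even where I jumps.  Once the states are frozen the gain is
   concave in the control, so one may replace the controls by midpoint convex
   combinations of tails, and minimal L2 norm together with the parallelogram
   identity makes such combinations converge almost everywhere. *)
Require Import Defs.
From mathcomp Require Import all_boot all_order all_algebra.
From mathcomp Require Import all_classical all_reals all_analysis.
From mathcomp Require Import measurable_realfun ring lra.
Set Implicit Arguments. Unset Strict Implicit. Unset Printing Implicit Defensive.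
Import Order.TTheory GRing.Theory Num.Theory.
Import numFieldNormedType.Exports.
Local Open Scope classical_set_scope.
Local Open Scope ring_scope.

(** * Gain of a leaf as a function of width and density *)

(** The payoff is not concave in the control: [- c * z^alpha] is convex in [z], and [I] is an
    arbitrary monotone function. Height and mass, however, are linear in [(p, u)]. Averaging
    controls whose states are already close to a common limit therefore keeps the states close to
    it, and concavity is only asked of the gain with the light frozen at its limit. Without an
    envelope a maximizing sequence of densities could concentrate into an atom, since a bound in L1
    gives no compactness; domination by one integrable [phi] excludes this and also feeds every use
    of dominated convergence. The exponent [1/alpha] arises as follows: [z^alpha <= M/t] gives
    [z^(alpha-1) >= (t/M)^(1/alpha-1)], the marginal cost of mass carried at [t], and a leaf at [s]
    is carried for all [t] in []0, s]]. Integrating yields the power [s^(1/alpha)], and [phi] is the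
    level at which [exp (- phi)] equals this marginal cost. *)

Section gain.
Context {R : realType}.
Implicit Types w u v p q : R.

(** With [w = cos (th - theta0)] this is [Gfun]. It is the perspective of the concave function
    [1 - exp (- x)], hence its joint concavity in [(w, u)]. *)
Definition gain w u : R := (1 - expR (- u / w)) * w.

(** The convexity of [expR] in tangent form; the finer inequalities on [gain] below are instances of
    it, so no derivative of [gain] is computed. *)
Lemma expR_tangent (x y : R) : expR y * (1 + (x - y)) <= expR x.
Proof.
have := expR_ge1Dx (x - y); rewrite -(ler_pM2l (expR_gt0 y)) -expRD.
by rewrite subrKC.
Qed.

Lemma gain_ge0 w u : 0 < w -> 0 <= u -> 0 <= gain w u.
Proof.
move=> w0 u0; rewrite /gain mulr_ge0 ?(ltW w0)// subr_ge0 -expR0 ler_expR.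
by rewrite mulNr oppr_le0 divr_ge0// ltW.
Qed.

Lemma gain_le_width w u : 0 < w -> gain w u <= w.
Proof.
move=> w0; rewrite /gain -[leRHS]mul1r ler_pM2r// lerBlDr lerDl.
Qed.

Lemma gain_le w u : 0 < w -> gain w u <= u.
Proof.
move=> w0; have := expR_ge1Dx (- u / w); rewrite -(ler_pM2r w0) mulrDl.
by rewrite divfK ?gt_eqF// /gain; lra.
Qed.

Lemma gain0 w : gain w 0 = 0.
Proof. by rewrite /gain oppr0 mul0r expR0 subrr mul0r. Qed.

(** The tangent at [v / w] has slope [exp (- v / w)] in [u], and [w <= 1] weakens it to [exp (- v)],
    a bound free of the width. It prices the light lost when [u] is cut down to [v]. *)
Lemma gain_lipschitz w u v : 0 < w <= 1 -> 0 <= v <= u ->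
  gain w u - gain w v <= expR (- v) * (u - v).
Proof.
move=> /andP[w0 w1] /andP[v0 vu].
have := expR_tangent (- u / w) (- v / w); rewrite -(ler_pM2r w0).
have -> : expR (- v / w) * (1 + (- u / w - - v / w)) * w =
    expR (- v / w) * w - expR (- v / w) * (u - v).
  by field; rewrite gt_eqF.
have : expR (- v / w) * (u - v) <= expR (- v) * (u - v).
  rewrite ler_wpM2r ?subr_ge0// ler_expR mulNr lerN2 ler_peMr// invf_ge1//.
by rewrite /gain; lra.
Qed.

(** With [X = u / w'], the tangent at [- X] bounds the difference below by
    [(w' - w) * (1 - exp (- X) * (1 + X))], and both factors are nonnegative. *)
Lemma le_gain w w' u : 0 < w <= w' -> 0 <= u -> gain w u <= gain w' u.
Proof.
move=> /andP[w0 ww'] u0; have w'0 := lt_le_trans w0 ww'.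
have := expR_tangent (- u / w) (- u / w'); rewrite -(ler_pM2r w0).
have -> : expR (- u / w') * (1 + (- u / w - - u / w')) * w =
    expR (- u / w') * (w - u + (u / w') * w).
  by field; rewrite !gt_eqF.
set X := u / w'; have -> : - u / w' = - X by rewrite mulNr.
have X1 : expR (- X) * (1 + X) <= 1.
  rewrite expRN mulrC ler_pdivrMr ?expR_gt0// mul1r; exact: expR_ge1Dx.
have uX : u = X * w' by rewrite divfK// gt_eqF.
have := ler_wpM2l (_ : 0 <= w' - w) X1; rewrite subr_ge0 => /(_ ww').
rewrite /gain -/X mulNr -/X {1}uX; set e := expR (- X).
by rewrite -/X -/e !mulNr -/X -/e; nra.
Qed.

(** Both exponentials are bounded by tangents at the same point [- m], where [m] is the ratio of
    density to width at the midpoint. In the sum the linear terms cancel because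
    [m * (w + w') = u + u']. *)
Lemma gain_midpoint_concave w w' u u' : 0 < w -> 0 < w' ->
  gain w u + gain w' u' <= 2 * gain ((w + w') / 2) ((u + u') / 2).
Proof.
move=> w0 w'0; set m := (u + u') / (w + w').
have mE : (u + u') / 2 / ((w + w') / 2) = m.
  by rewrite /m; field; rewrite gt_eqF ?addr_gt0.
have mD : m * (w + w') = u + u' by rewrite divfK// gt_eqF// addr_gt0.
clearbody m; have h (x y : R) :
    0 < x -> expR (- m) * (x - y + m * x) <= expR (- (y / x)) * x.
  move=> x0; have := expR_tangent (- (y / x)) (- m); rewrite -(ler_pM2r x0).
  by congr (_ <= _); field; rewrite gt_eqF.
have := h w u w0; have := h w' u' w'0.
by rewrite /gain !mulNr mE; nra.
Qed.

Lemma le_gain_r w u v : 0 < w -> u <= v -> gain w u <= gain w v.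
Proof.
move=> w0 uv; rewrite /gain ler_pM2r// lerB// ler_expR !mulNr lerN2.
by rewrite ler_pM2r ?invr_gt0.
Qed.

End gain.

(** * Leaf width as a function of the sine of the stem angle *)

Section width.
Context {R : realType}.
Variable theta0 : R.
Hypothesis theta0_itv : 0 < theta0 < pi / 2.
Implicit Types p q u v : R.

(* [cos (th - theta0)] as a function of [p = sin th]. *)
Definition width p : R := cos theta0 * Num.sqrt (1 - p ^+ 2) + sin theta0 * p.

Let s0_gt0 : 0 < sin theta0.
Proof.
by apply: sin_gt0_pi; case/andP: theta0_itv => -> h/=; have := pi_gt0 R; lra.
Qed.

Let c0_gt0 : 0 < cos theta0.
Proof.
apply: cos_gt0_pihalf; case/andP: theta0_itv => h1 h2; rewrite h2 andbT.
by rewrite (lt_trans _ h1)// oppr_lt0 (lt_trans h1).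
Qed.

Lemma width_sin th : theta0 <= th <= pi / 2 -> width (sin th) = cos (th - theta0).
Proof.
move=> /andP[h1 h2]; rewrite /width cosB.
have cth : 0 <= cos th.
  by apply: cos_ge0_pihalf; rewrite h2 andbT; case/andP: theta0_itv; lra.
have -> : 1 - sin th ^+ 2 = cos th ^+ 2 by rewrite cos2sin2.
by rewrite sqrtr_sqr ger0_norm// (mulrC (cos th)) (mulrC (sin th)).
Qed.

Lemma width_gt0 p : sin theta0 <= p -> 0 < width p.
Proof.
move=> sp; rewrite /width ltr_wpDl ?mulr_ge0 ?sqrtr_ge0 ?(ltW c0_gt0)//.
by rewrite mulr_gt0// (lt_le_trans s0_gt0).
Qed.

(** Cauchy-Schwarz for the unit vectors [(cos theta0, sin theta0)] and [(sqrt (1 - p^2), p)]. *)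
Lemma width_le1 p : sin theta0 <= p <= 1 -> width p <= 1.
Proof.
move=> /andP[sp p1]; have p0 : 0 <= p by rewrite (le_trans _ sp)// ltW.
have q0 := sqrtr_ge0 (1 - p ^+ 2).
have : Num.sqrt (1 - p ^+ 2) ^+ 2 = 1 - p ^+ 2.
  by rewrite sqr_sqrtr// subr_ge0 expr_le1.
have := cos2Dsin2 theta0; rewrite /width.
set a := cos _; set b := sin _; set q := Num.sqrt _ => h1 h2.
have := sqr_ge0 (a - q); have := sqr_ge0 (b - p); nra.
Qed.

(** Only the quarter circle [sqrt (1 - p^2)] matters: the midpoint of two points of the circle lies
    in the disc. *)
Lemma width_midpoint_concave p q : sin theta0 <= p <= 1 -> sin theta0 <= q <= 1 ->
  (width p + width q) / 2 <= width ((p + q) / 2).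
Proof.
move=> /andP[sp p1] /andP[sq q1].
have p0 : 0 <= p by rewrite (le_trans _ sp)// ltW.
have q0 : 0 <= q by rewrite (le_trans _ sq)// ltW.
have x0 := sqrtr_ge0 (1 - p ^+ 2).
have y0 := sqrtr_ge0 (1 - q ^+ 2).
have xE : Num.sqrt (1 - p ^+ 2) ^+ 2 = 1 - p ^+ 2.
  by rewrite sqr_sqrtr// subr_ge0 expr_le1.
have yE : Num.sqrt (1 - q ^+ 2) ^+ 2 = 1 - q ^+ 2.
  by rewrite sqr_sqrtr// subr_ge0 expr_le1.
suff : (Num.sqrt (1 - p ^+ 2) + Num.sqrt (1 - q ^+ 2)) / 2 <=
       Num.sqrt (1 - ((p + q) / 2) ^+ 2).
  by rewrite /width => /(ler_wpM2l (ltW c0_gt0)); lra.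
set x := Num.sqrt (1 - p ^+ 2) in x0 xE *; set y := Num.sqrt (1 - q ^+ 2) in y0 yE *.
rewrite -(@ler_pXn2r _ 2)// ?nnegrE ?sqrtr_ge0 ?divr_ge0 ?addr_ge0//.
rewrite sqr_sqrtr; last by nra.
have := sqr_ge0 (p - q); have := sqr_ge0 (x - y); nra.
Qed.

(** Joint concavity of [gain] survives the substitution of a concave width because [gain] is
    monotone in the width. Midpoints suffice, as the hulls used later are generated by midpoints. *)
Lemma rate_midpoint_concave p q u v :
  sin theta0 <= p <= 1 -> sin theta0 <= q <= 1 -> 0 <= u -> 0 <= v ->
  (gain (width p) u + gain (width q) v) / 2 <=
  gain (width ((p + q) / 2)) ((u + v) / 2).
Proof.
move=> hp hq u0 v0.
have wp : 0 < width p by apply: width_gt0; case/andP: hp.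
have wq : 0 < width q by apply: width_gt0; case/andP: hq.
have := gain_midpoint_concave u v wp wq.
have : gain ((width p + width q) / 2) ((u + v) / 2) <=
    gain (width ((p + q) / 2)) ((u + v) / 2).
  apply: le_gain; last by rewrite divr_ge0// addr_ge0.
  by rewrite width_midpoint_concave// andbT divr_gt0// addr_gt0.
lra.
Qed.

Lemma cvg_rate (p_ u_ : nat -> R) p u : sin theta0 <= p ->
  p_ @ \oo --> p -> u_ @ \oo --> u ->
  gain (width (p_ n)) (u_ n) @[n --> \oo] --> gain (width p) u.
Proof.
move=> sp pp uu; have w0 := width_gt0 sp.
have ww : width (p_ n) @[n --> \oo] --> width p.
  apply: cvgD; last by apply: cvgM => //; exact: cvg_cst.
  apply: cvgM; first exact: cvg_cst.
  apply: cvg_comp; last exact: sqrt_continuous.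
  apply: cvgB; first exact: cvg_cst.
  by rewrite expr2; under eq_fun do rewrite expr2; exact: cvgM.
apply: cvgM => //; apply: cvgB; first exact: cvg_cst.
apply: cvg_comp; last exact: continuous_expR.
apply: cvgM; first exact: cvgN.
by apply: cvgV => //; rewrite gt_eqF.
Qed.

Lemma measurable_rate (D : set R) (p u : R -> R) : measurable D ->
  (forall t, D t -> sin theta0 <= p t) ->
  measurable_fun D p -> measurable_fun D u ->
  measurable_fun D (fun t => gain (width (p t)) (u t)).
Proof.
move=> mD sp mp mu_.
have mw : measurable_fun D (fun t => width (p t)).
  apply: measurable_funD; apply: measurable_funM => //.
  apply: (@measurableT_comp _ _ _ _ _ _ (@Num.sqrt R)).
    by apply: continuous_measurable_fun; exact: sqrt_continuous.
  by apply: measurable_funB => //; exact: measurable_funX.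
apply: measurable_funM => //; apply: measurable_funB => //.
apply: (@measurableT_comp _ _ _ _ _ _ (@expR R)); first exact: measurable_expR.
apply: measurable_funM; first exact: measurable_funN.
(* The reciprocal is read as the power [-1], which agrees with it on positive widths and is
   measurable. *)
apply: (eq_measurable_fun (fun t => (width (p t)) `^ (-1))).
  move=> t /set_mem Dt; rewrite powR_inv1// ltW// width_gt0//; exact: sp.
exact: (@measurableT_comp _ _ _ _ _ _ (@powR R ^~ (-1)) _ _ (measurable_powR _) mw).
Qed.

End width.

(** * Monotone functions *)

Section monotone.
Context {R : realType}.
Implicit Types f g : R -> R.

(** Discontinuities of a monotone function are jumps, countably many in each window []-n, n[]. Off
    their union the one-sided limits agree and squeeze the value [f x]. *)
Lemma nondecreasing_ae_continuous f : nondecreasing_fun f ->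
  {ae (@lebesgue_measure R), forall x, {for x, continuous f}}.
Proof.
move=> ndf.
pose N := \bigcup_(n : nat)
  [set x : R | x \in (`](- n%:R), n%:R[) /\ discontinuity f x].
have cN : countable N.
  apply: bigcup_countable => // n _.
  by apply: discontinuity_countable => x y _ _; exact: ndf.
exists N; split.
- exact: countable_measurable.
- exact: countable_lebesgue_measure0.
move=> x /= ncont; apply: contrapT => Nx; apply: ncont.
have cl : cvg (f y @[y --> x^'-]).
  apply: nondecreasing_at_left_is_cvgr.
    by near=> a => u v _ _; exact: ndf.
  near=> a; exists (f x) => _ /= [y + <-].
  by rewrite in_itv/= => /andP[_ /ltW]; exact: ndf.
have cr : cvg (f y @[y --> x^'+]).
  apply: nondecreasing_at_right_is_cvgr.
    by near=> a => u v _ _; exact: ndf.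
  near=> a; exists (f x) => _ /= [y + <-].
  by rewrite in_itv/= => /andP[/ltW + _]; exact: ndf.
have lr : lim (f y @[y --> x^'-]) = lim (f y @[y --> x^'+]).
  apply: contrapT => /eqP ne; apply: Nx.
  exists (Num.truncn `|x|).+1 => //=; split; last by split.
  by rewrite in_itv/= -ltr_norml truncnS_gt.
have lx : lim (f y @[y --> x^'-]) <= f x.
  apply: limr_le => //; near=> y; apply: ndf.
  by near: y; exact: nbhs_left_le.
have xr : f x <= lim (f y @[y --> x^'+]).
  apply: limr_ge => //; near=> y; apply: ndf.
  by near: y; exact: nbhs_right_ge.
have lE : lim (f y @[y --> x^'-]) = f x by apply/eqP; rewrite eq_le lx lr xr.
have rE : lim (f y @[y --> x^'+]) = f x by rewrite -lr.
apply/left_right_continuousP; split.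
  by rewrite -[X in _ --> X]lE.
by rewrite -[X in _ --> X]rE.
Unshelve. all: end_near. Qed.

Lemma cvg_monotone_squeeze (f_ : nat -> R -> R) f (A : set R) x :
  (forall n, nondecreasing_fun (f_ n)) ->
  (forall a b, a < b -> exists2 q, A q & a < q < b) ->
  (forall q, A q -> f_ n q @[n --> \oo] --> f q) ->
  {for x, continuous f} -> f_ n x @[n --> \oo] --> f x.
Proof.
move=> nd dA cA cx; apply/cvgrPdist_lt => e e0.
have e2 : 0 < e / 2 by rewrite divr_gt0.
move/cvgrPdist_lt : cx => /(_ _ e2) [d /= d0 hd].
have [q1 Aq1 /andP[q11 q12]] := dA (x - d) x ltac:(by rewrite ltrBlDr ltrDl).
have [q2 Aq2 /andP[q21 q22]] := dA x (x + d) ltac:(by rewrite ltrDl).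
have h1 : `|f x - f q1| < e / 2.
  by apply: hd; rewrite /ball/= gtr0_norm; lra.
have h2 : `|f x - f q2| < e / 2.
  by apply: hd; rewrite /ball/= ltr0_norm; lra.
move/cvgrPdist_lt : (cA _ Aq1) => /(_ _ e2) H1.
move/cvgrPdist_lt : (cA _ Aq2) => /(_ _ e2) H2.
near=> n.
have k1 : `|f q1 - f_ n q1| < e / 2 by near: n.
have k2 : `|f q2 - f_ n q2| < e / 2 by near: n.
have := nd n _ _ (ltW q12); have := nd n _ _ (ltW q21).
by move: h1 h2 k1 k2; rewrite !ltr_norml => /andP[? ?] /andP[? ?] /andP[? ?] /andP[? ?] ? ?; lra.
Unshelve. all: end_near. Qed.

(** The limit is first taken along an ultrafilter finer than [\oo], where it exists at every point
    by compactness of [[- M x, M x]]; no diagonal extraction is needed. An ordinary sequence is then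
    recovered by choosing [s n] so that [f_ (s n)] is close to [f] at the first [n] rationals. [s]
    need not be increasing: [n <= s n] already sends it to infinity. *)
Lemma helly_selection (f_ : nat -> R -> R) (M : R -> R) :
  (forall n, nondecreasing_fun (f_ n)) ->
  (forall n x, `|f_ n x| <= M x) ->
  exists2 s : nat -> nat, (forall n, (n <= s n)%N) &
  exists2 f, nondecreasing_fun f &
    forall x, {for x, continuous f} -> f_ (s n) x @[n --> \oo] --> f x.
Proof.
move=> nd bM.
have [U [UU sU]] := ultraFilterLemma (F := \oo : set_system nat) _.
have PU : ProperFilter U by exact: ultra_proper.
have /choice[f fU] : forall x : R, exists l : R, f_ n x @[n --> U] --> l.
  move=> x.
  have [|l [_ cl]] := @segment_compact R (- M x) (M x) (f_ n x @[n --> U]).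
    have h : U [set n | `[- M x, M x]%classic (f_ n x)].
      apply: filterS (@filterT _ U _) => n _ /=.
      by rewrite in_itv/= -ler_norml; exact: bM.
    exact: h.
  (* For an ultrafilter a cluster point is a limit: if the preimage of [B] were not in [U], its
     complement would be, and the cluster property would give a point in both. *)
  exists l => B lB; have [//|UB] := in_ultra_setVsetC (f_^~ x @^-1` B) UU.
  have [y [+ By]] := cl (~` B) B UB lB.
  by move=> /(_ By).
have ndF : nondecreasing_fun f.
  move=> x y xy; apply: ler_cvg_to (fU x) (fU y) _.
  by apply: filterS filterT => n _; exact: nd.
(* An enumeration of the rationals; codes of no rational are sent to 0, which only repeats a
   value. *)
pose q (i : nat) : R := ratr (odflt 0 (unpickle i : option rat)).
have /choice[s sP] : forall n : nat, exists m : nat, (n <= m)%N /\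
    forall i, (i < n)%N -> `|f (q i) - f_ m (q i)| < n.+1%:R^-1.
  move=> n.
  suff : U [set m : nat | (n <= m)%N /\
    forall i, (i < n)%N -> `|f (q i) - f_ m (q i)| < n.+1%:R^-1].
    by move/filter_ex.
  apply: filterI; first by apply: sU; exact: nbhs_infty_ge.
  have : forall k, (k <= n)%N -> U [set m | forall i, (i < k)%N ->
      `|f (q i) - f_ m (q i)| < n.+1%:R^-1].
    elim=> [|k ih] kn; first by apply: filterS filterT.
    have := fU (q k); move/cvgrPdist_lt => /(_ n.+1%:R^-1 _).
    rewrite invr_gt0 ltr0n => /(_ isT) h; have := ih (ltnW kn).
    apply: filterS2 h => m h1 h2 i; rewrite ltnS leq_eqVlt => /predU1P[->//|].
    exact: h2.
  exact.
exists s => [n|]; first by case: (sP n).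
exists f => // x cx.
apply: (@cvg_monotone_squeeze (fun n => f_ (s n)) f (range q)) => //.
- move=> a b /rat_in_itvoo[r]; rewrite in_itv/= => rab.
  by exists (ratr r) => //; exists (pickle r) => //; rewrite /q pickleK.
- move=> _ [i _ <-]; apply/cvgrPdist_lt => e e0; near=> n.
  have /(_ _) h := (sP n).2 i.
  apply: (@lt_trans _ _ n.+1%:R^-1).
    by apply: h; near: n; exact: nbhs_infty_gt.
  by near: n; exact: near_infty_natSinv_lt (PosNum e0).
Unshelve. all: end_near. Qed.

End monotone.

(** * Almost sure limits of midpoint hulls *)

Section real_integrable.
Context d (T : measurableType d) {R : realType} (mu : {measure set T -> \bar R}).
Variable D : set T.
Hypothesis mD : measurable D.
Implicit Types f g : T -> R.

Lemma integrable_addr f g : mu.-integrable D (EFin \o f) ->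
  mu.-integrable D (EFin \o g) -> mu.-integrable D (EFin \o (fun t => f t + g t)).
Proof. exact: (@integrableD _ _ _ mu D mD (EFin \o f) (EFin \o g)). Qed.

Lemma integrable_subr f g : mu.-integrable D (EFin \o f) ->
  mu.-integrable D (EFin \o g) -> mu.-integrable D (EFin \o (fun t => f t - g t)).
Proof. exact: (@integrableB _ _ _ mu D mD (EFin \o f) (EFin \o g)). Qed.

Lemma integrable_mulrl (r : R) f : mu.-integrable D (EFin \o f) ->
  mu.-integrable D (EFin \o (fun t => r * f t)).
Proof. exact: (@integrableZl _ _ _ mu D mD r (EFin \o f)). Qed.

End real_integrable.

Section midhull_def.
Context {X : Type} {R : realType}.
Implicit Types (P U : X -> R) (p u : nat -> X -> R).

(** Both components are averaged by the same tree of midpoints, so that a pair in the hull is still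
    a control. The index [n] bounds the tail from which the leaves of the tree are drawn. *)
Inductive midhull p u (n : nat) : (X -> R) -> (X -> R) -> Prop :=
| midhull_tail k : (n <= k)%N -> midhull p u n (p k) (u k)
| midhull_mid P U P' U' : midhull p u n P U -> midhull p u n P' U' ->
    midhull p u n (fun t => (P t + P' t) / 2) (fun t => (U t + U' t) / 2).

Lemma midhullS p u m n P U : (m <= n)%N -> midhull p u n P U -> midhull p u m P U.
Proof.
move=> mn; elim=> [k nk|*]; first by apply: midhull_tail; exact: leq_trans nk.
exact: midhull_mid.
Qed.

End midhull_def.

Section midhull_limit.
Context d (T : measurableType d) {R : realType} (mu : {measure set T -> \bar R}).
Variable D : set T.
Hypotheses (mD : measurable D) (finD : (mu D < +oo)%E).

Lemma bounded_integrable (f : T -> R) (M : R) : measurable_fun D f ->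
  (forall t, D t -> `|f t| <= M) -> mu.-integrable D (EFin \o f).
Proof.
move=> mf bf; apply: measurable_bounded_integrable => //.
exists M; split; first exact: num_real.
by move=> N MN t Dt /=; exact: le_trans (bf _ Dt) (ltW MN).
Qed.

(** Steps [2^-(j+1)]: squared L2 distances will be of order [q j ^+ 2], hence L1 distances of the
    summable order [q j]. *)
Let q (j : nat) : R := ((2 ^ (j + 1))%:R)^-1.

Let q_gt0 j : 0 < q j. Proof. by rewrite invr_gt0 ltr0n expn_gt0. Qed.

Let q_le j : q j.+1 <= q j.
Proof. by rewrite lef_pV2 ?posrE ?ltr0n ?expn_gt0// ler_nat leq_pexp2l// addSn. Qed.

(** On a set of finite measure [|x| <= q + x^2 / q] turns the L2 bound into an L1 bound of order
    [q j]. The sum of the absolute increments then has a finite integral, so it is finite almost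
    everywhere and the telescoping series converges absolutely there. *)
Lemma fast_cauchy_ae_cvg (f : nat -> T -> R) (C : R) :
  (forall j, measurable_fun D (f j)) ->
  (forall j t, D t -> 0 <= f j t <= 1) ->
  (forall j, Rintegral mu D (fun t => (f j.+1 t - f j t) ^+ 2) <= C * (q j) ^+ 2) ->
  {ae mu, forall t, D t -> cvgn (f ^~ t)}.
Proof.
move=> mf bf hf; pose m := fine (mu D).
have m0 : 0 <= m by rewrite fine_ge0.
have C0 : 0 <= C.
  have := le_trans (Rintegral_ge0 mu (fun t _ => sqr_ge0 _)) (hf 0).
  by rewrite pmulr_lge0// exprn_gt0.
have md j : measurable_fun D (fun t => f j.+1 t - f j t) by exact: measurable_funB.
have bd j t : D t -> `|f j.+1 t - f j t| <= 1.
  by move=> Dt; have := bf j t Dt; have := bf j.+1 t Dt; rewrite ler_norml; lra.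
have id j : mu.-integrable D (EFin \o (fun t => `|f j.+1 t - f j t|)).
  apply: (@bounded_integrable _ 1); first exact: measurableT_comp.
  by move=> t Dt; rewrite normr_id bd.
have id2 j : mu.-integrable D (EFin \o (fun t => (f j.+1 t - f j t) ^+ 2)).
  apply: (@bounded_integrable _ 1); first exact: measurable_funX.
  by move=> t Dt; rewrite normrX expr_le1// bd.
have icst (r : R) : mu.-integrable D (EFin \o cst r).
  by apply: (@bounded_integrable _ `|r|).
have bound j : Rintegral mu D (fun t => `|f j.+1 t - f j t|) <= (m + C) * q j.
  apply: (@le_trans _ _ (Rintegral mu D
      (fun t => q j + (q j)^-1 * (f j.+1 t - f j t) ^+ 2))).
    apply: le_Rintegral => //.
      apply: (integrable_addr mD (icst (q j))).
      exact: (integrable_mulrl mD (q j)^-1 (id2 j)).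
    move=> t Dt; rewrite -real_normK ?num_real//.
    set x := `|_|; have x0 : 0 <= x by exact: normr_ge0.
    rewrite -(ler_pM2l (q_gt0 j)) mulrDr mulrA divff ?gt_eqF// mul1r.
    have := q_gt0 j; nra.
  rewrite RintegralD//; [|exact: icst|exact: (integrable_mulrl mD (q j)^-1 (id2 j))].
  rewrite Rintegral_cst// RintegralZl// mulrDl mulrC lerD2l.
  rewrite ler_pdivrMl// mulrCA -expr2; exact: hf.
pose s t := (\sum_(j <oo) (`|f j.+1 t - f j t|)%:E)%E.
have ms j : measurable_fun D (fun t => (`|f j.+1 t - f j t|)%:E).
  exact/measurable_EFinP/measurableT_comp.
have is_ : mu.-integrable D s.
  apply/integrableP; split.
    by apply: ge0_emeasurable_sum => // j t Dt _; rewrite lee_fin.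
  under eq_integral.
    move=> t _; rewrite gee0_abs; last by apply: nneseries_ge0 => j _; rewrite lee_fin.
    over.
  rewrite integral_nneseries//.
  apply: (@le_lt_trans _ _ (\sum_(j <oo) (((m + C) / (2 ^ (j + 1))%:R)%:E))%E).
    apply: lee_nneseries => [j *|j *]; first by apply: integral_ge0 => t *; rewrite lee_fin.
    have fin : (\int[mu]_(t in D) (`|f j.+1 t - f j t|)%:E)%E \is a fin_num.
      exact: (integrable_fin_num mD (id j)).
    by rewrite -(fineK fin) lee_fin; exact: bound.
  by rewrite (cvg_lim _ (@cvg_geometric_eseries_half R (m + C) 0))// ltry.
have := integrable_ae mD is_; apply: filterS => t + Dt => /(_ Dt) fin.
pose w j := f j.+1 t - f j t.
have cn : cvgn (series (fun j => `|w j|)).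
  apply: nondecreasing_is_cvgn.
    by apply/nondecreasing_seqP => n; rewrite /series/= big_nat_recr//= lerDl.
  exists (fine (s t)) => _ [n _ <-].
  rewrite -lee_fin fineK// /series/= -sumEFin.
  by apply: (nneseries_lim_ge n) => j _ _; rewrite lee_fin.
have cs : cvgn (series w) by exact: normed_cvg cn.
have -> : f ^~ t = fun n => f 0%N t + series w n.
  by apply/funext => n; rewrite /series/= /w telescope_sumr// addrC subrK.
by apply: is_cvgD => //; exact: is_cvg_cst.
Qed.

(* Almost minimisers of the L2 norm over the shrinking hulls form a Cauchy
   sequence by the parallelogram identity. *)
Lemma midhull_ae_cvg (p u : nat -> T -> R) :
  (forall k, measurable_fun D (p k)) -> (forall k, measurable_fun D (u k)) ->
  (forall k t, D t -> 0 <= p k t <= 1) -> (forall k t, D t -> 0 <= u k t <= 1) ->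
  exists P U : nat -> T -> R, (forall j, midhull p u j (P j) (U j)) /\
    {ae mu, forall t, D t -> cvgn (P ^~ t) /\ cvgn (U ^~ t)}.
Proof.
move=> mp mu_ bp bu.
have hull n P U : midhull p u n P U ->
    [/\ measurable_fun D P, measurable_fun D U,
        (forall t, D t -> 0 <= P t <= 1) & (forall t, D t -> 0 <= U t <= 1)].
  elim=> [k _|{}P {}U P' U' _ [mP mU bP bU] _ [mP' mU' bP' bU']]; first by split => // t Dt; [exact: bp|exact: bu].
  split.
  - by apply: measurable_funM => //; exact: measurable_funD.
  - by apply: measurable_funM => //; exact: measurable_funD.
  - by move=> t Dt; have := bP t Dt; have := bP' t Dt; lra.
  - by move=> t Dt; have := bU t Dt; have := bU' t Dt; lra.
pose sq (f g : T -> R) t := f t ^+ 2 + g t ^+ 2.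
pose N f g := Rintegral mu D (sq f g).
have isq (f g : T -> R) : measurable_fun D f -> measurable_fun D g ->
    (forall t, D t -> `|f t| <= 1) -> (forall t, D t -> `|g t| <= 1) ->
    mu.-integrable D (EFin \o sq f g).
  move=> mf mg bf bg; apply: (@bounded_integrable _ 2).
    by apply: measurable_funD; exact: measurable_funX.
  move=> t Dt; rewrite ger0_norm ?addr_ge0 ?sqr_ge0//.
  have : f t ^+ 2 <= 1 by rewrite -real_normK ?num_real// expr_le1// bf.
  have : g t ^+ 2 <= 1 by rewrite -real_normK ?num_real// expr_le1// bg.
  by rewrite /sq; lra.
have n01 (x : R) : 0 <= x <= 1 -> `|x| <= 1 by rewrite ler_norml; lra.
have N0 (f g : T -> R) : 0 <= N f g.
  by apply: Rintegral_ge0 => t _; rewrite addr_ge0 ?sqr_ge0.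
have NB n P U : midhull p u n P U -> N P U <= 2 * fine (mu D).
  move=> /hull[mP mU bP bU]; rewrite -Rintegral_cst//; apply: le_Rintegral => //.
  - by apply: isq => // t Dt; apply: n01; auto.
  - by apply: (@bounded_integrable _ `|2|).
  - move=> t Dt; rewrite /sq; have := bP t Dt; have := bU t Dt; nra.
(* Squared norms attained on the hull of the [n]-th tail. Their infima [a n] increase as the hulls
   shrink, and stay bounded because all values lie in [[0, 1]]; [M] is their supremum. *)
pose S n := [set x | exists P U, midhull p u n P U /\ x = N P U].
have Sinf n : has_inf (S n).
  split; last by exists 0 => _ [P [U [_ ->]]].
  by exists (N (p n) (u n)), (p n), (u n); split => //; exact: midhull_tail.
pose a n := inf (S n).
have aN n P U : midhull p u n P U -> a n <= N P U.
  by move=> h; apply: ge_inf; [case: (Sinf n)|exists P, U].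
have asup : has_sup (range a).
  split; first by exists (a 0%N), 0%N.
  exists (2 * fine (mu D)) => _ [n _ <-].
  have h : midhull p u n (p n) (u n) by exact: midhull_tail.
  exact: le_trans (aN _ _ _ h) (NB _ _ _ h).
have aM n : a n <= sup (range a) by apply: ub_le_sup; [case: asup|exists n].
set M := sup (range a) in aM.
have and_ m n : (m <= n)%N -> a m <= a n.
  move=> mn; apply: lb_le_inf; first by case: (Sinf n).
  by move=> _ [P [U [h ->]]]; apply: aN; exact: midhullS h.
(* The index is taken so large that every element of its hull has squared norm above [M - q j ^+ 2],
   and the pair in that hull has squared norm below [M + q j ^+ 2]. *)
have pick j : exists PUn : (T -> R) * (T -> R) * nat,
    [/\ (j <= PUn.2)%N, M - q j ^+ 2 < a PUn.2,
        midhull p u PUn.2 PUn.1.1 PUn.1.2 & N PUn.1.1 PUn.1.2 < M + q j ^+ 2].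
  have e0 : 0 < q j ^+ 2 by rewrite exprn_gt0.
  have [_ [n0 _ <-] h0] := sup_adherent e0 asup.
  pose n := maxn j n0.
  have [_ [P [U [h ->]]] h1] := inf_adherent e0 (Sinf n).
  exists (P, U, n) => /=; split => //; first exact: leq_maxl.
    by apply: (lt_le_trans h0); apply: and_; exact: leq_maxr.
  by apply: (lt_le_trans h1); rewrite lerD2r aM.
have {pick}[F hF] := choice pick.
pose P j := (F j).1.1; pose U j := (F j).1.2; pose n_ j := (F j).2.
exists P, U; split.
  by move=> j; have [jn _ h _] := hF j; exact: midhullS h.
have mP j : measurable_fun D (P j) by have [_ _ /hull[]] := hF j.
have mU j : measurable_fun D (U j) by have [_ _ /hull[]] := hF j.
have bP j t : D t -> 0 <= P j t <= 1 by have [_ _ /hull[_ _ h _] _] := hF j; exact: h.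
have bU j t : D t -> 0 <= U j t <= 1 by have [_ _ /hull[_ _ _ h] _] := hF j; exact: h.
(* The midpoint of two consecutive choices lies in the larger of the two hulls, so its squared norm
   is at least [M - q j ^+ 2]. The identity then leaves [2 + 2 + 4 = 8] times [q j ^+ 2]. *)
have parallelogram j :
    N (fun t => P j.+1 t - P j t) (fun t => U j.+1 t - U j t) <= 8 * q j ^+ 2.
  pose P' t := (P j.+1 t + P j t) / 2; pose U' t := (U j.+1 t + U j t) / 2.
  have qq : q j.+1 ^+ 2 <= q j ^+ 2 by rewrite lerXn2r ?nnegrE ?(ltW (q_gt0 _))// q_le.
  have [_ a1 h1 N1] := hF j.+1; have [_ a2 h2 N2] := hF j.
  have : M - q j ^+ 2 <= N P' U'.
    have h : midhull p u (minn (n_ j.+1) (n_ j)) P' U'.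
      apply: midhull_mid; [apply: midhullS h1; exact: geq_minl|
                           apply: midhullS h2; exact: geq_minr].
    apply: le_trans (aN _ _ _ h); rewrite /minn; case: ifPn => _; last exact: ltW.
    by apply: (le_trans _ (ltW a1)); rewrite lerB.
  have iP' : mu.-integrable D (EFin \o sq P' U').
    apply: isq; rewrite /P' /U'.
    - by apply: measurable_funM => //; exact: measurable_funD.
    - by apply: measurable_funM => //; exact: measurable_funD.
    - by move=> t Dt; apply: n01; have := bP j t Dt; have := bP j.+1 t Dt; lra.
    - by move=> t Dt; apply: n01; have := bU j t Dt; have := bU j.+1 t Dt; lra.
  have iN k : mu.-integrable D (EFin \o sq (P k) (U k)).
    by apply: isq => // t Dt; apply: n01; auto.
  have iD : mu.-integrable D (EFin \o
      sq (fun t => P j.+1 t - P j t) (fun t => U j.+1 t - U j t)).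
    apply: isq; try exact: measurable_funB.
    - by move=> t Dt; have := bP j t Dt; have := bP j.+1 t Dt; rewrite ler_norml; lra.
    - by move=> t Dt; have := bU j t Dt; have := bU j.+1 t Dt; rewrite ler_norml; lra.
  have : N (fun t => P j.+1 t - P j t) (fun t => U j.+1 t - U j t) + 4 * N P' U' =
      2 * N (P j.+1) (U j.+1) + 2 * N (P j) (U j).
    have E : N (fun t => P j.+1 t - P j t) (fun t => U j.+1 t - U j t) =
        Rintegral mu D (fun t => 2 * sq (P j.+1) (U j.+1) t + 2 * sq (P j) (U j) t
          - 4 * sq P' U' t).
      by apply: eq_Rintegral => t _; rewrite /sq /P' /U'; field.
    have i1 := integrable_mulrl mD 2 (iN j.+1).
    have i2 := integrable_mulrl mD 2 (iN j).
    have i3 := integrable_mulrl mD 4 iP'.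
    have i12 := integrable_addr mD i1 i2.
    by rewrite E RintegralB// RintegralD// !RintegralZl// subrK.
  by move: N1 N2; rewrite -/(P j.+1) -/(U j.+1) -/(P j) -/(U j); lra.
have half (f g : nat -> T -> R) : (forall j, measurable_fun D (f j)) ->
    (forall j, measurable_fun D (g j)) ->
    (forall j t, D t -> 0 <= f j t <= 1) -> (forall j t, D t -> 0 <= g j t <= 1) ->
    (forall j, N (fun t => f j.+1 t - f j t) (fun t => g j.+1 t - g j t) <= 8 * q j ^+ 2) ->
    {ae mu, forall t, D t -> cvgn (f ^~ t)}.
  move=> mf mg bf bg h; apply: (@fast_cauchy_ae_cvg _ 8) => // j.
  apply: le_trans (h j); apply: le_Rintegral => //.
  - apply: (@bounded_integrable _ 1); first by apply/measurable_funX/measurable_funB.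
    move=> t Dt; rewrite normrX expr_le1//.
    by have := bf j t Dt; have := bf j.+1 t Dt; rewrite ler_norml; lra.
  - apply: isq; try exact: measurable_funB.
    + by move=> t Dt; have := bf j t Dt; have := bf j.+1 t Dt; rewrite ler_norml; lra.
    + by move=> t Dt; have := bg j t Dt; have := bg j.+1 t Dt; rewrite ler_norml; lra.
  - by move=> t Dt; rewrite /sq lerDl sqr_ge0.
have cP := half P U mP mU bP bU parallelogram.
have cU : {ae mu, forall t, D t -> cvgn (U ^~ t)}.
  apply: (half U P) => // j; apply: le_trans (parallelogram j).
  by rewrite le_eqVlt; apply/orP; left; apply/eqP/eq_Rintegral => t _; rewrite /sq addrC.
by move: cP cU; apply: filterS2 => t h1 h2 Dt; split; auto.
Qed.

End midhull_limit.

(** * Optimal controls below an integrable envelope *)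

Section Rintegral_limits.
Context d (T : measurableType d) {R : realType} (mu : {measure set T -> \bar R}).
Variable D : set T.
Hypothesis mD : measurable D.

Lemma le_integrable_EFin (f g : T -> R) : measurable_fun D f ->
  (forall t, D t -> `|f t| <= g t) ->
  mu.-integrable D (EFin \o g) -> mu.-integrable D (EFin \o f).
Proof.
move=> mf fg ig; apply: (@le_integrable _ _ _ mu D mD _ (EFin \o g)) => //.
  exact/measurable_EFinP.
move=> t Dt /=; rewrite lee_fin (le_trans (fg _ Dt))//; exact: ler_norm.
Qed.

Lemma Rdominated_cvg (f_ : nat -> T -> R) (f g : T -> R) :
  (forall n, measurable_fun D (f_ n)) -> measurable_fun D f ->
  {ae mu, forall t, D t -> f_ n t @[n --> \oo] --> f t} ->
  (forall n t, D t -> `|f_ n t| <= g t) ->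
  mu.-integrable D (EFin \o g) ->
  Rintegral mu D (f_ n) @[n --> \oo] --> Rintegral mu D f.
Proof.
move=> mf_ mf ff fg ig.
have [||||ifin _ +] := @dominated_convergence _ _ _ mu D mD
   (fun n => EFin \o f_ n) (EFin \o f) (EFin \o g) _ _ _ ig _.
- by move=> n; exact/measurable_EFinP.
- exact/measurable_EFinP.
- move: ff; apply: filterS => t h Dt.
  by apply: cvg_EFin; [exact: nearW|exact: h].
- by apply: aeW => t n Dt /=; rewrite lee_fin; exact: fg.
move=> h; apply: fine_cvg.
rewrite /Rintegral fineK; first exact: h.
exact: (integrable_fin_num mD ifin).
Qed.

Lemma ae_eq_Rintegral (f g : T -> R) : measurable_fun D f -> measurable_fun D g ->
  {ae mu, forall t, D t -> f t = g t} -> Rintegral mu D f = Rintegral mu D g.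
Proof.
move=> mf mg fg; congr fine; apply: ae_eq_integral => //.
- exact/measurable_EFinP.
- exact/measurable_EFinP.
- by move: fg; apply: filterS => t h Dt; rewrite h.
Qed.

End Rintegral_limits.

(** For [l > 0] this is continuity of [exp (a * ln x)]. At [l = 0], a value that the limit mass may
    take, [ln] is of no help and [x < e^(1/a)] gives [x^a < e] directly. *)
Lemma cvg_powR {R : realType} (u : nat -> R) (l a : R) : 0 < a ->
  (forall n, 0 <= u n) -> 0 <= l -> u n @[n --> \oo] --> l ->
  u n `^ a @[n --> \oo] --> l `^ a.
Proof.
move=> a0 u0; rewrite le_eqVlt => /predU1P[<-|l0] ul.
  rewrite powR0 ?gt_eqF//; apply/cvgrPdist_lt => e e0.
  have e'0 : 0 < e `^ a^-1 by rewrite powR_gt0.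
  move/cvgrPdist_lt : ul => /(_ _ e'0); apply: filterS => n.
  rewrite !sub0r !normrN ger0_norm// ger0_norm ?powR_ge0// => h.
  have -> : e = (e `^ a^-1) `^ a by rewrite -powRrM mulVf ?gt_eqF// powRr1// ltW.
  by rewrite gt0_ltr_powR// nnegrE// ltW.
have -> : l `^ a = expR (a * ln l) by rewrite /powR gt_eqF.
have : expR (a * ln (u n)) @[n --> \oo] --> expR (a * ln l).
  apply: cvg_comp; last exact: continuous_expR.
  apply: cvgM; first exact: cvg_cst.
  by apply: cvg_comp; [exact: ul|exact: continuous_ln].
apply: cvg_trans; apply: near_eq_cvg.
move/cvgrPdist_lt : ul => /(_ _ l0); apply: filterS => n h.
have un : 0 < u n by move: h; rewrite ltr_norml; lra.
by rewrite /powR gt_eqF.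
Qed.

(* Restated over [R] itself, whose canonical measurable structure is not
   syntactically the one on which [lebesgue_measure] is defined. *)
Section lebesgue.
Context {R : realType}.
Notation mu := (@lebesgue_measure R).

Lemma lebesgue_aeS (P Q : R -> Prop) : (forall t, P t -> Q t) ->
  {ae mu, forall t, P t} -> {ae mu, forall t, Q t}.
Proof. by move=> PQ; apply: negligibleS => t /= nQ Pt; apply/nQ/PQ. Qed.

Lemma lebesgue_aeS2 (P P' Q : R -> Prop) : (forall t, P t -> P' t -> Q t) ->
  {ae mu, forall t, P t} -> {ae mu, forall t, P' t} -> {ae mu, forall t, Q t}.
Proof.
move=> PQ aP aP'; apply: negligibleS (negligibleU aP aP') => t /= nQ.
by apply: contrapT => /not_orP[/contrapT p /contrapT p']; apply/nQ/PQ.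
Qed.

Variable A : set R.
Hypothesis mA : measurable A.
Implicit Types f g : R -> R.

Lemma lebesgue_bounded_integrable f (M : R) : (mu A < +oo)%E ->
  measurable_fun A f -> (forall t, A t -> `|f t| <= M) -> mu.-integrable A (EFin \o f).
Proof.
by move=> finA mf bf; apply: (@bounded_integrable _ _ _ mu A _ _ f M).
Qed.

Lemma lebesgue_le_integrable f g : measurable_fun A f ->
  (forall t, A t -> `|f t| <= g t) -> mu.-integrable A (EFin \o g) ->
  mu.-integrable A (EFin \o f).
Proof. by move=> *; apply: (@le_integrable_EFin _ _ _ mu A _ f g). Qed.

Lemma lebesgue_dominated_cvg (f_ : nat -> R -> R) f g :
  (forall n, measurable_fun A (f_ n)) -> measurable_fun A f ->
  {ae mu, forall t, A t -> f_ n t @[n --> \oo] --> f t} ->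
  (forall n t, A t -> `|f_ n t| <= g t) -> mu.-integrable A (EFin \o g) ->
  Rintegral mu A (f_ n) @[n --> \oo] --> Rintegral mu A f.
Proof. by move=> *; apply: (@Rdominated_cvg _ _ _ mu A _ f_ f g). Qed.

Lemma lebesgue_ae_eq_Rintegral f g : measurable_fun A f -> measurable_fun A g ->
  {ae mu, forall t, A t -> f t = g t} -> Rintegral mu A f = Rintegral mu A g.
Proof. by move=> *; apply: (@ae_eq_Rintegral _ _ _ mu A). Qed.

Lemma lebesgue_RintegralD f g : mu.-integrable A (EFin \o f) ->
  mu.-integrable A (EFin \o g) ->
  Rintegral mu A (fun t => f t + g t) = Rintegral mu A f + Rintegral mu A g.
Proof. by move=> *; apply: (@RintegralD _ _ _ mu A f g). Qed.

Lemma lebesgue_RintegralZ (r : R) f : mu.-integrable A (EFin \o f) ->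
  Rintegral mu A (fun t => r * f t) = r * Rintegral mu A f.
Proof. by move=> *; apply: (@RintegralZl _ _ _ mu A f r). Qed.

Lemma lebesgue_integrableD f g : mu.-integrable A (EFin \o f) ->
  mu.-integrable A (EFin \o g) -> mu.-integrable A (EFin \o (fun t => f t + g t)).
Proof. by move=> *; apply: (@integrable_addr _ _ _ mu A). Qed.

Lemma lebesgue_integrableB f g : mu.-integrable A (EFin \o f) ->
  mu.-integrable A (EFin \o g) -> mu.-integrable A (EFin \o (fun t => f t - g t)).
Proof. by move=> *; apply: (@integrable_subr _ _ _ mu A). Qed.

Lemma lebesgue_integrableZ (r : R) f : mu.-integrable A (EFin \o f) ->
  mu.-integrable A (EFin \o (fun t => r * f t)).
Proof. by move=> *; apply: (@integrable_mulrl _ _ _ mu A). Qed.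

Lemma lebesgue_le_Rintegral f g : mu.-integrable A (EFin \o f) ->
  mu.-integrable A (EFin \o g) -> (forall t, A t -> f t <= g t) ->
  Rintegral mu A f <= Rintegral mu A g.
Proof. by move=> *; apply: (@le_Rintegral _ _ _ mu A). Qed.

Lemma lebesgue_midhull_ae_cvg (p u : nat -> R -> R) : (mu A < +oo)%E ->
  (forall k, measurable_fun A (p k)) -> (forall k, measurable_fun A (u k)) ->
  (forall k t, A t -> 0 <= p k t <= 1) -> (forall k t, A t -> 0 <= u k t <= 1) ->
  exists P U : nat -> R -> R, (forall j, midhull p u j (P j) (U j)) /\
    {ae mu, forall t, A t -> cvgn (P ^~ t) /\ cvgn (U ^~ t)}.
Proof. by move=> *; apply: (@midhull_ae_cvg _ _ _ mu A). Qed.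

End lebesgue.

Section bounded_controls.
Context {R : realType}.
Notation mu := (@lebesgue_measure R).
Variables (theta0 alpha c T : R) (I phi : R -> R).
Implicit Types (p q u h : R -> R) (r s t x : R) (A : set R).
Hypothesis theta0_itv : 0 < theta0 < pi / 2.
Hypothesis alpha_gt0 : 0 < alpha.
Hypothesis c_gt0 : 0 < c.
Hypothesis T_gt0 : 0 < T.
Hypothesis I_range : forall x, 0 <= x -> 0 <= I x <= 1.
Hypothesis I_mono : forall x y, 0 <= x -> x <= y -> I x <= I y.
Hypothesis measurable_phi : measurable_fun setT phi.
Hypothesis phi_ge0 : forall t, 0 <= phi t.
Hypothesis phi_eq0 : forall t, ~ `[0, T]%classic t -> phi t = 0.
Hypothesis integrable_phi : mu.-integrable setT (EFin \o phi).

Let s0 := sin theta0.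
Let D : set R := `[0, T]%classic.

Let mD : measurable D. Proof. exact: measurable_itv. Qed.

Let muD : mu D = T%:E.
Proof. by rewrite /D lebesgue_measure_itv/= lte_fin T_gt0 sube0. Qed.

Let finD : (mu D < +oo)%E. Proof. by rewrite muD ltry. Qed.

Let s0_gt0 : 0 < s0.
Proof.
by apply: sin_gt0_pi; case/andP: theta0_itv => -> h/=; have := pi_gt0 R; lra.
Qed.

(** [p] stands for [sin th]. The conditions are imposed on the whole line, negative times included,
    so that measurability needs no restriction to a domain. *)
Definition control (p u : R -> R) : Prop :=
  [/\ measurable_fun setT p, measurable_fun setT u,
      (forall t, s0 <= p t <= 1) & (forall t, 0 <= u t <= phi t)].

Definition climb (p : R -> R) (t : R) : R := Rintegral mu `[0, t]%classic p.

Definition rate (p u : R -> R) (t : R) : R := gain (width theta0 (p t)) (u t).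

Definition payoff (p u : R -> R) : R :=
  Rintegral mu D (fun t => I (climb p t) * rate p u t - c * zstate u t `^ alpha).

(** [I] is monotone on the half line only; this constant extension is monotone on the whole line, as
    the lemmas on monotone functions require. *)
Let I0 (x : R) : R := I (Num.max x 0).

Let I0_mono : nondecreasing_fun I0.
Proof. move=> x y xy; apply: I_mono; first by rewrite le_max lexx orbT.
by rewrite ge_max !le_max lexx orbT xy. Qed.

Let I0_range x : 0 <= I0 x <= 1.
Proof. by apply: I_range; rewrite le_max lexx orbT. Qed.

Let I0E x : 0 <= x -> I0 x = I x.
Proof. by move=> x0; rewrite /I0 max_l. Qed.

Lemma integrable_height p t : measurable_fun setT p -> (forall t, s0 <= p t <= 1) ->
  mu.-integrable `[0, t]%classic (EFin \o p).
Proof.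
move=> mp bp; apply: (@lebesgue_bounded_integrable _ _ _ _ 1) => //.
- by rewrite lebesgue_measure_itv/=; case: ifPn => //= _; rewrite ?EFinB ltry.
- exact: measurable_funTS.
- move=> x _; have /andP[h1 h2] := bp x; rewrite ger0_norm// (le_trans _ h1)//.
  exact: ltW.
Qed.

Lemma climb_ge0 p t : (forall t, s0 <= p t <= 1) -> 0 <= climb p t.
Proof.
move=> bp; apply: Rintegral_ge0 => x _; have /andP[h1 h2] := bp x.
by rewrite (le_trans _ h1)// ltW.
Qed.

(** The lower slope [s0 > 0] is what makes limit heights strictly increasing; the upper one gives
    the bound needed for Helly selection. *)
Lemma climbB p s t : measurable_fun setT p -> (forall t, s0 <= p t <= 1) ->
  0 <= s -> s <= t ->
  s0 * (t - s) <= climb p t - climb p s <= t - s.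
Proof.
move=> mp bp s_ge0 st; have ip := integrable_height t mp bp.
rewrite /climb Rintegral_itvB ?bnd_simp//.
have st_sub : `]s, t]%classic `<=` `[0, t]%classic.
  by apply: subset_itvr; rewrite bnd_simp.
have ip' : mu.-integrable `]s, t]%classic (EFin \o p).
  by apply: integrableS ip.
have mst : mu `]s, t]%classic = (t - s)%:E.
  rewrite lebesgue_measure_itv/= lte_fin; case: ifPn => [|]; first by rewrite EFinB.
  by rewrite -leNgt => ts; rewrite (_ : t = s) ?subrr//; apply/eqP; rewrite eq_le ts st.
have cst_int (r : R) : mu.-integrable `]s, t]%classic (EFin \o cst r).
  by apply: (@lebesgue_bounded_integrable _ _ _ _ `|r|) => //; rewrite mst ltry.
have cstE (r : R) : Rintegral mu `]s, t]%classic (cst r) = r * (t - s).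
  transitivity (r * fine (mu `]s, t]%classic)); last by rewrite mst.
  by apply: (@Rintegral_cst _ _ _ mu).
apply/andP; split; [rewrite -cstE|rewrite -[leRHS]mul1r -cstE];
  apply: le_Rintegral => //; try exact: cst_int;
  by move=> x _; case/andP: (bp x).
Qed.

Lemma climb0 p : climb p 0 = 0.
Proof. by rewrite /climb set_itv1 Rintegral_set1. Qed.

Lemma climb_le p s t : measurable_fun setT p -> (forall t, s0 <= p t <= 1) ->
  s <= t -> climb p s <= climb p t.
Proof.
move=> mp bp st; have [s_ge0|s_lt0] := leP 0 s.
  have /andP[h _] := climbB mp bp s_ge0 st; rewrite -subr_ge0; apply: le_trans h.
  by rewrite mulr_ge0 ?subr_ge0// ltW.
rewrite [leLHS](_ : _ = 0) ?climb_ge0// /climb set_itv_ge ?Rintegral_set0//.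
by rewrite bnd_simp -ltNge.
Qed.

Lemma integrable_control u (A : set R) : measurable A -> measurable_fun setT u ->
  (forall t, 0 <= u t <= phi t) -> mu.-integrable A (EFin \o u).
Proof.
move=> mA mu_ bu; apply: (@lebesgue_le_integrable _ _ _ _ phi) => //.
- exact: measurable_funTS.
- by move=> t _; have /andP[h1 h2] := bu t; rewrite ger0_norm.
- exact: integrableS integrable_phi.
Qed.

Lemma zstate_bounds u t : measurable_fun setT u -> (forall t, 0 <= u t <= phi t) ->
  0 <= zstate u t <= Rintegral mu setT phi.
Proof.
move=> mu_ bu; apply/andP; split.
  by apply: Rintegral_ge0 => x _; case/andP: (bu x).
rewrite /zstate /Rintegral fine_le//.
- by apply: (integrable_fin_num _ (integrable_control _ mu_ bu)).
- exact: (integrable_fin_num _ integrable_phi).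
apply: (@le_trans _ _ (\int[mu]_(x in `[t, +oo[) (phi x)%:E)%E).
  apply: ge0_le_integral => //.
  - by move=> x _; rewrite lee_fin; case/andP: (bu x).
  - exact/measurable_EFinP/measurable_funTS.
  - exact/measurable_EFinP/measurable_funTS.
  - by move=> x _; rewrite lee_fin; case/andP: (bu x).
apply: ge0_subset_integral => //; first exact/measurable_EFinP.
by move=> x _; rewrite lee_fin.
Qed.

Lemma zstate_le u s t : measurable_fun setT u -> (forall t, 0 <= u t <= phi t) ->
  s <= t -> zstate u t <= zstate u s.
Proof.
move=> mu_ bu st; rewrite /zstate /Rintegral fine_le//.
- by apply: (integrable_fin_num _ (integrable_control _ mu_ bu)).
- by apply: (integrable_fin_num _ (integrable_control _ mu_ bu)).
apply: ge0_subset_integral => //; first exact/measurable_EFinP/measurable_funTS.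
  by move=> x _; rewrite lee_fin; case/andP: (bu x).
by apply: subset_itvr; rewrite bnd_simp.
Qed.

Lemma rate_bounds p u t : s0 <= p t <= 1 -> 0 <= u t -> 0 <= rate p u t <= 1.
Proof.
move=> bp bu; have w0 : 0 < width theta0 (p t).
  by apply: width_gt0 => //; case/andP: bp.
rewrite gain_ge0//= (le_trans (gain_le_width _ w0))//.
exact: width_le1.
Qed.

Lemma measurable_cost u : measurable_fun setT u -> (forall t, 0 <= u t <= phi t) ->
  measurable_fun setT (fun t => c * zstate u t `^ alpha).
Proof.
move=> mu_ bu; apply: measurable_funM => //.
apply: (@measurableT_comp _ _ _ _ _ _ (@powR R ^~ alpha)); first exact: measurable_powR.
by apply: nonincreasing_measurable => // s t; exact: zstate_le.
Qed.

Lemma integrable_cost u : measurable_fun setT u -> (forall t, 0 <= u t <= phi t) ->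
  mu.-integrable D (EFin \o (fun t => c * zstate u t `^ alpha)).
Proof.
move=> mu_ bu.
apply: (@lebesgue_bounded_integrable _ _ _ _ (c * Rintegral mu setT phi `^ alpha)) => //.
  by apply: measurable_funTS; exact: measurable_cost.
move=> t _; have /andP[h1 h2] := zstate_bounds t mu_ bu.
rewrite ger0_norm; last by apply: mulr_ge0; [exact: ltW|exact: powR_ge0].
rewrite (ler_pM2l c_gt0).
by apply: ge0_ler_powR; rewrite ?nnegrE ?(ltW alpha_gt0)// (le_trans h1).
Qed.

Lemma measurable_control_rate p u (A : set R) : measurable A -> control p u ->
  measurable_fun A (rate p u).
Proof.
move=> mA [mp mu_ bp bu]; apply: measurable_rate => //.
- by move=> t _; case/andP: (bp t).
- exact: measurable_funTS.
- exact: measurable_funTS.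
Qed.

Lemma integrable_weighted_rate (h : R -> R) p u : control p u ->
  measurable_fun D h -> (forall t, D t -> 0 <= h t <= 1) ->
  mu.-integrable D (EFin \o (fun t => h t * rate p u t)).
Proof.
move=> cpu mh bh; apply: (@lebesgue_bounded_integrable _ _ _ _ 1) => //.
  by apply: measurable_funM => //; exact: measurable_control_rate.
move=> t Dt; have := bh t Dt; case: cpu => mp mu_ bp bu.
have /andP[h1 h2] := @rate_bounds p u t (bp t) (proj1 (andP (bu t))).
move=> /andP[h3 h4]; rewrite ger0_norm; last exact: mulr_ge0.
by rewrite -[leRHS]mulr1 ler_pM.
Qed.

Lemma measurable_light p : measurable_fun setT p -> (forall t, s0 <= p t <= 1) ->
  measurable_fun setT (fun t => I (climb p t)).
Proof.
move=> mp bp; apply: nondecreasing_measurable => // s t st.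
by apply: I_mono; [exact: climb_ge0|exact: climb_le].
Qed.

Lemma payoffE p u : control p u -> payoff p u =
  Rintegral mu D (fun t => I (climb p t) * rate p u t) -
  Rintegral mu D (fun t => c * zstate u t `^ alpha).
Proof.
move=> cpu; have [mp mu_ bp bu] := cpu.
rewrite /payoff RintegralB//; last exact: integrable_cost.
apply: integrable_weighted_rate => //.
  by apply: measurable_funTS; exact: measurable_light.
by move=> t _; apply: I_range; exact: climb_ge0.
Qed.

Lemma payoff_le p u : control p u -> payoff p u <= T.
Proof.
move=> cpu; have [mp mu_ bp bu] := cpu.
have iT : mu.-integrable D (EFin \o cst 1).
  by apply: (@lebesgue_bounded_integrable _ _ _ _ 1) => // t _ /=; rewrite normr1.
have -> : T = Rintegral mu D (cst 1).
  transitivity (1 * fine (mu D)); first by rewrite muD mul1r.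
  by apply/esym; apply: (@Rintegral_cst _ _ _ mu).
rewrite payoffE//.
have h1 : 0 <= Rintegral mu D (fun t => c * zstate u t `^ alpha).
  by apply: Rintegral_ge0 => t _; apply: mulr_ge0; [exact: ltW|exact: powR_ge0].
suff : Rintegral mu D (fun t => I (climb p t) * rate p u t) <= Rintegral mu D (cst 1).
  by move: h1; lra.
apply: le_Rintegral => //.
  apply: integrable_weighted_rate => //.
    by apply: measurable_funTS; exact: measurable_light.
  by move=> t _; apply: I_range; exact: climb_ge0.
move=> t _ /=; have /andP[h2 h3] := I_range (climb_ge0 t bp).
have /andP[h4 h5] := @rate_bounds p u t (bp t) (proj1 (andP (bu t))).
by rewrite -[leRHS]mulr1 ler_pM.
Qed.

Let mid (p q : R -> R) t := (p t + q t) / 2.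

Lemma control_mid p u p' u' : control p u -> control p' u' ->
  control (mid p p') (mid u u').
Proof.
move=> [mp mu_ bp bu] [mp' mu'_ bp' bu']; split.
- by apply: measurable_funM => //; exact: measurable_funD.
- by apply: measurable_funM => //; exact: measurable_funD.
- by move=> t; have := bp t; have := bp' t; rewrite /mid; lra.
- by move=> t; have := bu t; have := bu' t; rewrite /mid; lra.
Qed.

Lemma Rintegral_mid p q A : measurable A -> mu.-integrable A (EFin \o p) ->
  mu.-integrable A (EFin \o q) ->
  Rintegral mu A (mid p q) = (Rintegral mu A p + Rintegral mu A q) / 2.
Proof.
move=> mA ip iq; rewrite mulrC -lebesgue_RintegralD// -lebesgue_RintegralZ//.
  by apply: eq_Rintegral => t _; rewrite /mid mulrC.
exact: lebesgue_integrableD.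
Qed.

Let light_gain (h : R -> R) p u := Rintegral mu D (fun t => h t * rate p u t).

(** Concavity for frozen light, put as midpoint convexity of superlevel sets: in this form it passes
    through an induction over [midhull]. *)
Lemma light_gain_mid h p u p' u' r : measurable_fun D h ->
  (forall t, D t -> 0 <= h t <= 1) -> control p u -> control p' u' ->
  r <= light_gain h p u -> r <= light_gain h p' u' ->
  r <= light_gain h (mid p p') (mid u u').
Proof.
move=> mh bh cpu cpu' r1 r2.
have i1 := integrable_weighted_rate cpu mh bh.
have i2 := integrable_weighted_rate cpu' mh bh.
have cm := control_mid cpu cpu'.
have i3 := integrable_weighted_rate cm mh bh.
have i12 : mu.-integrable D (EFin \o
    mid (fun t => h t * rate p u t) (fun t => h t * rate p' u' t)).
  have := lebesgue_integrableZ mD 2^-1 (lebesgue_integrableD mD i1 i2).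
  by apply: eq_integrable => // t _ /=; rewrite /mid mulrC.
have : Rintegral mu D (mid (fun t => h t * rate p u t) (fun t => h t * rate p' u' t))
    <= light_gain h (mid p p') (mid u u').
  apply: le_Rintegral => // t Dt; have /andP[h0 h1] := bh _ Dt.
  rewrite /mid -mulrDr -mulrA ler_wpM2l//.
  case: cpu cpu' => _ _ bp bu [_ _ bp' bu'].
  apply: rate_midpoint_concave => //; [by case/andP: (bu t)|by case/andP: (bu' t)].
rewrite (Rintegral_mid mD i1 i2) -/(light_gain h p u) -/(light_gain h p' u').
by move: r1 r2; lra.
Qed.

Lemma cvg_climb (p_ : nat -> R -> R) p t : (forall n, measurable_fun setT (p_ n)) ->
  (forall n t, s0 <= p_ n t <= 1) -> measurable_fun setT p ->
  {ae mu, forall t, D t -> p_ n t @[n --> \oo] --> p t} -> D t ->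
  climb (p_ n) t @[n --> \oo] --> climb p t.
Proof.
move=> mp_ bp_ mp pp; rewrite /D/= in_itv/= => /andP[t0 tT].
apply: (@lebesgue_dominated_cvg _ _ _ _ _ (cst 1)) => //.
- by move=> n; exact: measurable_funTS.
- exact: measurable_funTS.
- move: pp; apply: lebesgue_aeS => x h xt; apply: h.
  by move: xt; rewrite /D/= !in_itv/= => /andP[-> /le_trans]; exact.
- move=> n x _ /=; have /andP[h1 h2] := bp_ n x.
  by rewrite ger0_norm// (le_trans _ h1)// ltW.
- apply: (@lebesgue_bounded_integrable _ _ _ _ 1) => //.
    by rewrite lebesgue_measure_itv/=; case: ifPn => //= _; rewrite ?EFinB ltry.
  by move=> x _ /=; rewrite normr1.
Qed.

Lemma cvg_zstate (u_ : nat -> R -> R) u t : (forall n, measurable_fun setT (u_ n)) ->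
  (forall n t, 0 <= u_ n t <= phi t) -> measurable_fun setT u ->
  {ae mu, forall t, D t -> u_ n t @[n --> \oo] --> u t} ->
  (forall t, 0 <= u t <= phi t) ->
  zstate (u_ n) t @[n --> \oo] --> zstate u t.
Proof.
move=> mu_ bu_ mu0 uu bu.
apply: (@lebesgue_dominated_cvg _ _ _ _ _ phi) => //.
- by move=> n; exact: measurable_funTS.
- exact: measurable_funTS.
(* Off [[0, T]] the envelope is 0, so all densities vanish and convergence on [D] is enough. *)
- move: uu; apply: lebesgue_aeS => x h _; have [/h//|nD] := pselect (D x).
  have u0 : u x = 0 by have := bu x; rewrite (phi_eq0 nD); lra.
  have -> : (fun n => u_ n x) = cst 0.
    by apply/funext => n; have := bu_ n x; rewrite (phi_eq0 nD)/=; lra.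
  by rewrite u0; exact: cvg_cst.
- by move=> n x _; have /andP[h1 h2] := bu_ n x; rewrite ger0_norm.
- exact: integrableS integrable_phi.
Qed.

Lemma cvg_light_gain h (p_ u_ : nat -> R -> R) p u : measurable_fun D h ->
  (forall t, D t -> 0 <= h t <= 1) ->
  (forall n, control (p_ n) (u_ n)) -> control p u ->
  {ae mu, forall t, D t -> p_ n t @[n --> \oo] --> p t} ->
  {ae mu, forall t, D t -> u_ n t @[n --> \oo] --> u t} ->
  light_gain h (p_ n) (u_ n) @[n --> \oo] --> light_gain h p u.
Proof.
move=> mh bh c_ cpu pp uu.
apply: (@lebesgue_dominated_cvg _ _ _ _ _ (cst 1)) => //.
- by move=> n; apply: measurable_funM => //; exact: measurable_control_rate.
- by apply: measurable_funM => //; exact: measurable_control_rate.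
- move: pp uu; apply: lebesgue_aeS2 => t h1 h2 Dt; apply: cvgM; first exact: cvg_cst.
  apply: cvg_rate => //; [|exact: h1|exact: h2].
  by case: cpu => _ _ bp _; case/andP: (bp t).
- move=> n t Dt /=; have /andP[h3 h4] := bh t Dt; have [mp mu_ bp bu] := c_ n.
  have /andP[h1 h2] := @rate_bounds (p_ n) (u_ n) t (bp t) (proj1 (andP (bu t))).
  rewrite ger0_norm; last exact: mulr_ge0.
  by rewrite -[leRHS]mulr1 ler_pM.
- by apply: (@lebesgue_bounded_integrable _ _ _ _ 1) => // t _ /=; rewrite normr1.
Qed.

Let ndV (f : R -> R) (d x : R) : nondecreasing_fun f -> 0 < d ->
  f (x - d) <= f x <= f (x + d).
Proof. by move=> nf d0; rewrite !nf//; lra. Qed.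

(* [I] may jump, but a strictly increasing limit height meets the jumps on a
   null set only. *)
Let cvg_light (f : R -> R) (y_ : nat -> R) t : nondecreasing_fun f ->
  {for t, continuous (fun x => I0 (f x + s0 * x))} ->
  y_ n @[n --> \oo] --> f t + s0 * t ->
  I0 (y_ n) @[n --> \oo] --> I0 (f t + s0 * t).
Proof.
move=> nf ch yt; apply/cvgrPdist_lt => e e0.
move/cvgrPdist_lt : ch => /(_ _ e0) [d /= d0 hd].
have d2 : 0 < d / 2 by rewrite divr_gt0.
have h1 := hd (t - d / 2) _; have h2 := hd (t + d / 2) _.
have {h1}: `|I0 (f t + s0 * t) - I0 (f (t - d / 2) + s0 * (t - d / 2))| < e.
  by apply: h1; rewrite /ball/= gtr0_norm; lra.
have {h2}: `|I0 (f t + s0 * t) - I0 (f (t + d / 2) + s0 * (t + d / 2))| < e.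
  by apply: h2; rewrite /ball/= ltr0_norm; lra.
move=> h2 h1; have /andP[f1 f2] := ndV t nf d2.
(* As [f] is nondecreasing, the limit heights at [t - d / 2] and [t + d / 2] lie at least
   [s0 * (d / 2)] below and above the one at [t]. Heights [y_ n] within this distance are sandwiched
   between them, and so is their light. *)
have sd : 0 < s0 * (d / 2) by rewrite mulr_gt0.
move/cvgrPdist_lt : yt => /(_ _ sd); apply: filterS => n.
rewrite ltr_norml => /andP[y1 y2].
have k1 : I0 (f (t - d / 2) + s0 * (t - d / 2)) <= I0 (y_ n).
  by apply: I0_mono; rewrite mulrBr; lra.
have k2 : I0 (y_ n) <= I0 (f (t + d / 2) + s0 * (t + d / 2)).
  by apply: I0_mono; rewrite mulrDr; lra.
by move: h1 h2; rewrite !ltr_norml => /andP[? ?] /andP[? ?]; lra.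
Qed.

Let cvg_ninfty (s : nat -> nat) : (forall n, (n <= s n)%N) -> s n @[n --> \oo] --> \oo.
Proof.
move=> ns B [N _ NB]; exists N => // n /= Nn.
by apply: NB => /=; exact: leq_trans (ns n).
Qed.

Lemma maximizing_sequence : exists p_ u_ : nat -> R -> R,
  (forall k, control (p_ k) (u_ k)) /\
      exists S : R, (forall p u, control p u -> payoff p u <= S) /\
        forall k, S - k.+1%:R^-1 < payoff (p_ k) (u_ k).
Proof.
pose V := [set x | exists p u, control p u /\ x = payoff p u].
have supV : has_sup V.
  split; last by exists T => _ [p [u [cpu ->]]]; exact: payoff_le.
  exists (payoff (cst 1) (cst 0)), (cst 1), (cst 0); split => //; split => //.
  - by move=> t /=; rewrite lexx andbT sin_le1.
  - by move=> t /=; rewrite lexx phi_ge0.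
have pick k : exists pu : (R -> R) * (R -> R),
    control pu.1 pu.2 /\ sup V - k.+1%:R^-1 < payoff pu.1 pu.2.
  have [|_ [p [u [cpu ->]]] h] := sup_adherent (_ : 0 < k.+1%:R^-1) supV.
    by rewrite invr_gt0.
  by exists (p, u).
have {pick}[F hF] := choice pick.
exists (fun k => (F k).1), (fun k => (F k).2); split.
- by move=> k; case: (hF k).
- exists (sup V); split; last by move=> k; case: (hF k).
  by move=> p u cpu; apply: ub_le_sup; [case: supV|exists p, u].
Qed.

(** Helly selection is applied to [climb - s0 * x], still nondecreasing by [climbB], so that strict
    growth of the limit height [f t + s0 * t] is visible in its form. The mass is nonincreasing and
    enters with a minus sign. *)
Lemma state_selection (p_ u_ : nat -> R -> R) : (forall k, control (p_ k) (u_ k)) ->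
  exists2 s : nat -> nat, (forall n, (n <= s n)%N) &
  exists2 f : R -> R, nondecreasing_fun f &
  exists2 g : R -> R, nondecreasing_fun g &
    {ae mu, forall t, D t -> climb (p_ (s n)) t @[n --> \oo] --> f t + s0 * t} /\
    {ae mu, forall t, zstate (u_ (s n)) t @[n --> \oo] --> - g t}.
Proof.
move=> ctl.
pose f_ k x := climb (p_ k) (Num.max x 0) - s0 * Num.max x 0.
have max0 x : 0 <= Num.max x 0 by rewrite le_max lexx orbT.
have [s1 ns1 [f nf cf]] : exists2 s : nat -> nat, (forall n, (n <= s n)%N) &
    exists2 f, nondecreasing_fun f &
    forall x, {for x, continuous f} -> f_ (s n) x @[n --> \oo] --> f x.
  apply: (@helly_selection _ f_ (fun x => Num.max x 0)).
  - move=> n x y xy; have [mp _ bp _] := ctl n.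
    have mm : Num.max x 0 <= Num.max y 0 by rewrite ge_max !le_max lexx orbT xy.
    by have /andP[+ _] := climbB mp bp (max0 x) mm; rewrite /f_ mulrBr; lra.
  - move=> n x; have [mp _ bp _] := ctl n.
    have := climbB mp bp (lexx 0) (max0 x).
    rewrite climb0 !subr0 /f_ => /andP[h1 h2].
    by rewrite ger0_norm ?subr_ge0// lerBlDr ler_wpDr// mulr_ge0// ltW.
(* The second selection runs along the first subsequence; at continuity points the height limit is
   inherited by the composite. *)
pose g_ k x := - zstate (u_ (s1 k)) x.
have [s2 ns2 [g ng cg]] : exists2 s : nat -> nat, (forall n, (n <= s n)%N) &
    exists2 g, nondecreasing_fun g &
    forall x, {for x, continuous g} -> g_ (s n) x @[n --> \oo] --> g x.
  apply: (@helly_selection _ g_ (fun=> Rintegral mu setT phi)).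
  - move=> n x y xy; have [_ mu_ _ bu] := ctl (s1 n).
    by rewrite lerN2; exact: zstate_le.
  - move=> n x; have [_ mu_ _ bu] := ctl (s1 n).
    by have /andP[h1 h2] := zstate_bounds x mu_ bu; rewrite normrN ger0_norm.
exists (s1 \o s2); first by move=> n /=; exact: leq_trans (ns1 _).
exists f => //; exists g => //; split.
- apply: lebesgue_aeS (nondecreasing_ae_continuous nf) => t ct.
  rewrite /D/= in_itv/= => /andP[t0 _].
  have h : f_ (s1 (s2 n)) t @[n --> \oo] --> f t.
    by apply: cvg_comp (cf t ct); exact: cvg_ninfty.
  have -> : (fun n => climb (p_ ((s1 \o s2) n)) t) =
      (fun n => f_ (s1 (s2 n)) t + s0 * t).
    by apply/funext => n; rewrite /f_ max_l//= subrK.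
  by apply: cvgD => //; exact: cvg_cst.
- apply: lebesgue_aeS (nondecreasing_ae_continuous ng) => t ct.
  have -> : (fun n => zstate (u_ ((s1 \o s2) n)) t) = - (fun n => g_ (s2 n) t).
    by apply/funext => n; rewrite /g_ fctE opprK.
  by apply: cvgN; exact: cg.
Qed.

(** * Limits of midpoint hulls of a maximizing sequence *)

Section limit_of_hulls.
Variables (P U : nat -> R -> R) (f g : R -> R).
Hypothesis ctlPU : forall k, control (P k) (U k).
Hypothesis nf : nondecreasing_fun f.
Hypothesis ng : nondecreasing_fun g.
Hypothesis climb_lim :
  {ae mu, forall t, D t -> climb (P n) t @[n --> \oo] --> f t + s0 * t}.
Hypothesis zstate_lim : {ae mu, forall t, zstate (U n) t @[n --> \oo] --> - g t}.

(** Light at the limit height, independent of the control. [I0] replaces [I] because [f t + s0 * t]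
    may be negative where it is not a limit of heights. *)
Let h t := I0 (f t + s0 * t).

Let nh : nondecreasing_fun h.
Proof.
by move=> x y xy; apply: I0_mono; rewrite lerD// ?nf// ler_wpM2l// ltW.
Qed.

Let mh : measurable_fun D h. Proof. exact: nondecreasing_measurable. Qed.

Let bh t : D t -> 0 <= h t <= 1. Proof. by move=> _; exact: I0_range. Qed.

Let cost t := c * (- g t) `^ alpha.

Let mcost : measurable_fun D cost.
Proof.
apply: measurable_funM => //.
apply: (@measurableT_comp _ _ _ _ _ _ (@powR R ^~ alpha)); first exact: measurable_powR.
by apply: nonincreasing_measurable => // x y xy; rewrite lerN2; exact: ng.
Qed.

Let light_lim :
  {ae mu, forall t, D t -> I (climb (P n) t) @[n --> \oo] --> h t}.
Proof.
have nfs : nondecreasing_fun h by exact: nh.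
apply: lebesgue_aeS2 climb_lim (nondecreasing_ae_continuous nfs) => t ct ch Dt.
have -> : (fun n => I (climb (P n) t)) = (fun n => I0 (climb (P n) t)).
  by apply/funext => n; rewrite I0E//; have [_ _ bp _] := ctlPU n; exact: climb_ge0.
exact: cvg_light (ct Dt).
Qed.

Lemma cost_lim : Rintegral mu D (fun t => c * zstate (U n) t `^ alpha) @[n --> \oo]
  --> Rintegral mu D cost.
Proof.
apply: (@lebesgue_dominated_cvg _ _ _ _ _ (cst (c * Rintegral mu setT phi `^ alpha))) => //.
- move=> n; have [_ mu_ _ bu] := ctlPU n.
  by apply: measurable_funTS; exact: measurable_cost.
- apply: lebesgue_aeS zstate_lim => t ct _.
  apply: cvgM; first exact: cvg_cst.
  apply: cvg_powR => //.
    by move=> n; have [_ mu_ _ bu] := ctlPU n; have /andP[] := zstate_bounds t mu_ bu.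
  rewrite -(cvg_lim (@Rhausdorff R) ct); apply: limr_ge; first exact: cvgP ct.
  near=> n.
  by have [_ mu_ _ bu] := ctlPU n; have /andP[] := zstate_bounds t mu_ bu.
- move=> n t _ /=; have [_ mu_ _ bu] := ctlPU n.
  have /andP[h1 h2] := zstate_bounds t mu_ bu.
  rewrite ger0_norm; last by apply: mulr_ge0; [exact: ltW|exact: powR_ge0].
  rewrite (ler_pM2l c_gt0).
  by apply: ge0_ler_powR; rewrite ?nnegrE ?(ltW alpha_gt0)// (le_trans h1).
- by apply: (@lebesgue_bounded_integrable _ _ _ _ `|c * Rintegral mu setT phi `^ alpha|).
Unshelve. all: end_near. Qed.

Let light_error n := Rintegral mu D (fun t => `|I (climb (P n) t) - h t|).

Let measurable_light_error n : measurable_fun D (fun t => `|I (climb (P n) t) - h t|).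
Proof.
have [mp _ bp _] := ctlPU n.
apply: measurableT_comp => //; apply: measurable_funB => //.
by apply: measurable_funTS; exact: measurable_light.
Qed.

Let light_error_le1 n t : `|I (climb (P n) t) - h t| <= 1.
Proof.
have [_ _ bp _] := ctlPU n; have := I_range (climb_ge0 t bp).
by have := I0_range (f t + s0 * t); rewrite -/(h t) ler_norml; lra.
Qed.

Lemma light_error_lim : light_error n @[n --> \oo] --> 0.
Proof.
have -> : 0 = Rintegral mu D (cst 0) by rewrite /Rintegral integral0_eq.
apply: (@lebesgue_dominated_cvg _ _ _ _ _ (cst 1)) => //.
- apply: lebesgue_aeS light_lim => t ct Dt.
  rewrite /cst -(normr0 R) -(subrr (h t)); apply: cvg_norm.
  by apply: cvgB; [exact: ct|exact: cvg_cst].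
- by move=> n t _; rewrite normr_id.
- by apply: (@lebesgue_bounded_integrable _ _ _ _ 1) => // t _ /=; rewrite normr1.
Qed.

(** The rate lies in [[0, 1]], so replacing the true light by [h] changes the gain by at most the L1
    distance of the two. *)
Lemma payoff_le_light_gain n : payoff (P n) (U n) <=
  light_gain h (P n) (U n) + light_error n -
  Rintegral mu D (fun t => c * zstate (U n) t `^ alpha).
Proof.
have ctl := ctlPU n; have [mp mu_ bp bu] := ctl; rewrite payoffE// lerB//.
have i1 := integrable_weighted_rate ctl mh bh.
have i2 : mu.-integrable D (EFin \o (fun t => `|I (climb (P n) t) - h t|)).
  apply: (@lebesgue_bounded_integrable _ _ _ _ 1) => //.
  by move=> t _; rewrite normr_id.
rewrite -lebesgue_RintegralD//; apply: lebesgue_le_Rintegral => //.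
- apply: integrable_weighted_rate => //.
    by apply: measurable_funTS; exact: measurable_light.
  by move=> t _; apply: I_range; exact: climb_ge0.
- exact: lebesgue_integrableD.
move=> t _; have /andP[r0 r1] := @rate_bounds (P n) (U n) t (bp t) (proj1 (andP (bu t))).
have := ler_norm (I (climb (P n) t) - h t).
have := normr_ge0 (I (climb (P n) t) - h t).
by set e := `|_|; nra.
Qed.

Variable S : R.
Hypothesis maximizing : forall n, S - n.+1%:R^-1 < payoff (P n) (U n).

(** The three thirds of [e] absorb the error in the cost, the error in the light and the defect of
    the maximizing sequence. *)
Lemma light_gain_ge e : 0 < e -> \forall n \near \oo,
  S + Rintegral mu D cost - e <= light_gain h (P n) (U n).
Proof.
move=> e0; have e3 : 0 < e / 3 by rewrite divr_gt0.
have arith (a ck l le pay i e' : R) : pay <= l + le - ck -> S - i < pay ->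
    `|a - ck| < e' / 3 -> `|0 - le| < e' / 3 -> i < e' / 3 -> S + a - e' <= l.
  by rewrite !ltr_norml; lra.
have := cost_lim; move/cvgrPdist_lt => /(_ _ e3) hc.
have := light_error_lim; move/cvgrPdist_lt => /(_ _ e3) hl.
near=> n.
have h1 : `|Rintegral mu D cost -
    Rintegral mu D (fun t => c * zstate (U n) t `^ alpha)| < e / 3 by near: n.
have h2 : `|0 - light_error n| < e / 3 by near: n.
have h3 : n.+1%:R^-1 < e / 3 by near: n; exact: near_infty_natSinv_lt (PosNum e3).
exact: arith (payoff_le_light_gain n) (maximizing n) h1 h2 h3.
Unshelve. all: end_near. Qed.

(** Each property passes to midpoints: controls form a convex set, the gain for frozen light is
    concave, and both states are linear in the control. The bounds [r] and [e] are quantified over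
    the tail only, so they are uniform over the whole hull. *)
Lemma midhull_properties n (V : nat -> R -> R) p v :
  (forall k t, V k t * (1 + phi t) = U k t) -> midhull P V n p v ->
  let u t := v t * (1 + phi t) in
  [/\ control p u,
      forall r, (forall k, (n <= k)%N -> r <= light_gain h (P k) (U k)) ->
        r <= light_gain h p u,
      forall t e, (forall k, (n <= k)%N -> `|f t + s0 * t - climb (P k) t| <= e) ->
        `|f t + s0 * t - climb p t| <= e &
      forall t e, (forall k, (n <= k)%N -> `|- g t - zstate (U k) t| <= e) ->
        `|- g t - zstate u t| <= e].
Proof.
move=> VU; elim=> {p v} [k nk|p v p' v' _ [ctl lg cl zs] _ [ctl' lg' cl' zs']] /=.
  have -> : (fun t => V k t * (1 + phi t)) = U k by apply/funext => t; exact: VU.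
  by split; auto.
have -> : (fun t => (v t + v' t) / 2 * (1 + phi t)) =
    mid (fun t => v t * (1 + phi t)) (fun t => v' t * (1 + phi t)).
  by apply/funext => t; rewrite /mid; lra.
rewrite -/(mid p p'); split.
- exact: control_mid.
- by move=> r hr; apply: light_gain_mid => //; [exact: lg|exact: lg'].
- move=> t e he; have := cl t e he; have := cl' t e he.
  case: ctl ctl' => mp _ bp _ [mp' _ bp' _].
  rewrite /climb Rintegral_mid//; try exact: integrable_height.
  by rewrite !ler_norml; lra.
- move=> t e he; have := zs t e he; have := zs' t e he.
  case: ctl ctl' => _ mu_ _ bu [_ mu' _ bu'].
  rewrite /zstate Rintegral_mid//; try exact: integrable_control.
  by rewrite !ler_norml; lra.
Qed.

Lemma attained : exists p u, control p u /\ S <= payoff p u.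
Proof.
(* Convergence of hulls is available for functions with values in [[0, 1]], while [phi] may be
   unbounded. Division by [1 + phi] rescales the densities and never divides by 0. *)
pose V k t := U k t / (1 + phi t).
have ph1 t : 0 < 1 + phi t by rewrite ltr_wpDr.
have VU k t : V k t * (1 + phi t) = U k t by rewrite /V divfK// gt_eqF.
have mV k : measurable_fun setT (V k).
  have [_ mu_ _ _] := ctlPU k; apply: measurable_funM => //.
  apply: (eq_measurable_fun (fun t => (1 + phi t) `^ (-1))).
    by move=> t _; rewrite powR_inv1// ltW.
  apply: (@measurableT_comp _ _ _ _ _ _ (@powR R ^~ (-1))); first exact: measurable_powR.
  exact: measurable_funD.
have [Q [W [hull aecvg]]] : exists Q W : nat -> R -> R,
    (forall j, midhull P V j (Q j) (W j)) /\
    {ae mu, forall t, D t -> cvgn (Q ^~ t) /\ cvgn (W ^~ t)}.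
  apply: lebesgue_midhull_ae_cvg => //.
  - by move=> k; have [mp _ _ _] := ctlPU k; exact: measurable_funTS.
  - by move=> k; exact: measurable_funTS.
  - move=> k t _; have [_ _ bp _] := ctlPU k.
    by have /andP[h1 ->] := bp t; rewrite andbT (le_trans _ h1)// ltW.
  - move=> k t _; have [_ _ _ bu] := ctlPU k; have /andP[h1 h2] := bu t.
    rewrite /V divr_ge0//=; last exact: ltW.
    by rewrite ler_pdivrMr// mul1r (le_trans h2)// lerDr.
pose Y j t := W j t * (1 + phi t).
have hullP n j : (n <= j)%N -> _ := fun nj => midhull_properties VU (midhullS nj (hull j)).
have ctlQY j : control (Q j) (Y j) by have [] := hullP j j (leqnn j).
have range_ub (w : nat -> R) a b : (forall n, a <= w n <= b) ->
    has_ubound (range w) /\ has_lbound (range w).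
  by move=> hw; split; [exists b|exists a] => _ [n _ <-]; case/andP: (hw n).
(* Clamped upper limits are measurable and obey the constraints at every point, also where the hull
   sequences diverge. *)
pose p t := Num.max s0 (Num.min 1 (limn_sup (fun j => Q j t))).
pose u t := Num.max 0 (Num.min (phi t) (limn_sup (fun j => Y j t))).
have s01 : s0 <= 1 by exact: sin_le1.
have bQ t n : s0 <= Q n t <= 1 by have [_ _ + _] := ctlQY n; exact.
have bY t n : 0 <= Y n t <= phi t by have [_ _ _ +] := ctlQY n; exact.
have ctl : control p u.
  split.
  - apply: measurable_maxr => //; apply: measurable_minr => //.
    apply: measurable_fun_limn_sup => [t _|t _|n].
    + by have [] := range_ub _ _ _ (bQ t).
    + by have [] := range_ub _ _ _ (bQ t).
    + by have [] := ctlQY n.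
  - apply: measurable_maxr => //; apply: measurable_minr => //.
    apply: measurable_fun_limn_sup => [t _|t _|n].
    + by have [] := range_ub _ _ _ (bY t).
    + by have [] := range_ub _ _ _ (bY t).
    + by have [] := ctlQY n.
  - by move=> t; rewrite /p le_max lexx/= ge_max s01 ge_min lexx.
  - by move=> t; rewrite /u le_max lexx/= ge_max phi_ge0 ge_min lexx.
have limQ t : cvgn (Q ^~ t) -> Q n t @[n --> \oo] --> p t.
  move=> cQ; have q1 : s0 <= limn (Q ^~ t).
    by apply: limr_ge => //; near=> n; case/andP: (bQ t n).
  have q2 : limn (Q ^~ t) <= 1.
    by apply: limr_le => //; near=> n; case/andP: (bQ t n).
  by rewrite /p (cvg_limn_supE cQ) min_r// max_r.
have limY t : cvgn (W ^~ t) -> Y n t @[n --> \oo] --> u t.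
  move=> cW; have cY : cvgn (Y ^~ t) by apply: is_cvgM => //; exact: is_cvg_cst.
  have q1 : 0 <= limn (Y ^~ t).
    by apply: limr_ge => //; near=> n; case/andP: (bY t n).
  have q2 : limn (Y ^~ t) <= phi t.
    by apply: limr_le => //; near=> n; case/andP: (bY t n).
  by rewrite /u (cvg_limn_supE cY) min_r// max_r.
have aeQ : {ae mu, forall t, D t -> Q n t @[n --> \oo] --> p t}.
  by apply: lebesgue_aeS aecvg => t ct Dt; apply: limQ; case: (ct Dt).
have aeY : {ae mu, forall t, D t -> Y n t @[n --> \oo] --> u t}.
  by apply: lebesgue_aeS aecvg => t ct Dt; apply: limY; case: (ct Dt).
have [mp mu_ bp bu] := ctl.
have eclimb : {ae mu, forall t, D t -> climb p t = f t + s0 * t}.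
  apply: lebesgue_aeS climb_lim => t ct Dt.
  apply: (@cvg_unique _ (@Rhausdorff R) (climb (Q n) t @[n --> \oo])).
    by apply: cvg_climb => // n; have [] := ctlQY n.
  apply/cvgrPdist_le => e e0; have /cvgrPdist_le /(_ _ e0)[N _ hN] := ct Dt.
  exists N => // n /= Nn; have [_ _ + _] := hullP N n Nn.
  by apply => k Nk; exact: hN.
have ezstate : {ae mu, forall t, D t -> zstate u t = - g t}.
  apply: lebesgue_aeS zstate_lim => t ct Dt.
  apply: (@cvg_unique _ (@Rhausdorff R) (zstate (Y n) t @[n --> \oo])).
    by apply: cvg_zstate => // n; have [] := ctlQY n.
  apply/cvgrPdist_le => e e0; have /cvgrPdist_le /(_ _ e0)[N _ hN] := ct.
  exists N => // n /= Nn; have [_ _ _] := hullP N n Nn.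
  by apply => k Nk; exact: hN.
have lg : S + Rintegral mu D cost <= light_gain h p u.
  apply/ler_addgt0Pr => e e0; rewrite -lerBlDr.
  have cl := cvg_light_gain mh bh ctlQY ctl aeQ aeY.
  rewrite -(cvg_lim (@Rhausdorff R) cl); apply: limr_ge; first exact: cvgP cl.
  have [N _ hN] := light_gain_ge e0.
  exists N => // n /= Nn; have [_ + _ _] := hullP N n Nn.
  by apply => k Nk; exact: hN.
exists p, u; split => //; rewrite payoffE//.
have -> : Rintegral mu D (fun t => c * zstate u t `^ alpha) = Rintegral mu D cost.
  apply: lebesgue_ae_eq_Rintegral => //.
    by apply: measurable_funTS; exact: measurable_cost.
  by apply: lebesgue_aeS ezstate => t et Dt; rewrite et.
have -> : Rintegral mu D (fun t => I (climb p t) * rate p u t) = light_gain h p u.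
  apply: lebesgue_ae_eq_Rintegral => //.
  - apply: measurable_funM; last exact: measurable_control_rate.
    by apply: measurable_funTS; exact: measurable_light.
  - by apply: measurable_funM => //; exact: measurable_control_rate.
  - apply: lebesgue_aeS eclimb => t et Dt.
    by rewrite /h -et// I0E//; exact: climb_ge0.
by move: lg; lra.
Unshelve. all: end_near. Qed.

End limit_of_hulls.

Theorem bounded_optimum : exists p u, control p u /\
  forall p' u', control p' u' -> payoff p' u' <= payoff p u.
Proof.
have [p_ [u_ [ctl [S [leS maxS]]]]] := maximizing_sequence.
have [s ns [f nf [g ng [cl zs]]]] := state_selection ctl.
have maxS' n : S - n.+1%:R^-1 < payoff (p_ (s n)) (u_ (s n)).
  apply: le_lt_trans (maxS _); rewrite lerB// lef_pV2 ?posrE ?ltr0n//.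
  by rewrite ler_nat ltnS.
have [p [u [cpu Spu]]] := attained (fun n => ctl (s n)) nf ng cl zs maxS'.
exists p, u; split; first exact: cpu.
by move=> p' u' ctl'; exact: le_trans (leS _ _ ctl') Spu.
Qed.

End bounded_controls.

(** * Truncation *)

Section powR_concave.
Context {R : realType}.
Implicit Types a x z M t : R.

(** Young's inequality for [x^a] and 1 with exponents [1/a] and [1/(1-a)]. *)
Lemma powR_le_tangent a x : 0 < a < 1 -> 0 <= x -> x `^ a <= 1 + a * (x - 1).
Proof.
move=> /andP[a0 a1] x0.
have b0 : 0 < 1 - a by rewrite subr_gt0.
have := @conjugate_powR R (x `^ a) 1 a^-1 (1 - a)^-1 (powR_ge0 _ _) ler01.
rewrite !invr_gt0 !invrK => /(_ a0 b0) H.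
have := H _; rewrite mulr1 -powRrM mulfV ?gt_eqF// powRr1// powR1 mul1r.
by move=> /(_ ltac:(by rewrite addrC subrK)); lra.
Qed.

(** The tangent of the concave power at [z] has slope [a * z^(a-1)]. Writing [z^(a-1)] as the power
    [1/a - 1] of [1 / z^a], the bound on [z^a] keeps it above [(t/M)^(1/a-1)]. *)
Lemma powR_diff_ge a M t (z z' : R) : 0 < a < 1 -> 0 < M -> 0 < t -> 0 <= z' <= z ->
  z `^ a <= M / t ->
  a * (t / M) `^ (a^-1 - 1) * (z - z') <= z `^ a - z' `^ a.
Proof.
move=> a01; have /andP[a0 a1] := a01 => M0 t0 /andP[z'0 z'z] zM.
have [z0|z0] := ltP 0 z; last first.
  have -> : z = 0 by apply/eqP; rewrite eq_le z0 (le_trans z'0).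
  have -> : z' = 0 by apply/eqP; rewrite eq_le z'0 (le_trans z'z).
  by rewrite !subrr mulr0.
have za : 0 < z `^ a by rewrite powR_gt0.
have kz : (t / M) `^ (a^-1 - 1) <= z `^ a / z.
  have -> : z `^ a / z = ((z `^ a)^-1) `^ (a^-1 - 1).
    rewrite -powRN -powRrM -[z in _ / z]powRr1 ?(ltW z0)// -powRN -powRD.
      by congr (_ `^ _); field; rewrite gt_eqF.
    by rewrite (gt_eqF z0) implybT.
  apply: ge0_ler_powR; rewrite ?nnegrE.
  - by rewrite subr_ge0 invf_ge1// ltW.
  - by apply: divr_ge0; exact: ltW.
  - by rewrite invr_ge0 ltW.
  - by rewrite -[t / M]invrK invf_div lef_pV2 ?posrE ?divr_gt0.
have x0 : 0 <= z' / z by apply: divr_ge0 => //; exact: ltW.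
have := powR_le_tangent a01 x0; rewrite -(ler_pM2l za) -powRM ?(ltW z0)//.
have -> : z * (z' / z) = z' by rewrite mulrC divfK// gt_eqF.
have -> : z `^ a * (1 + a * (z' / z - 1)) = z `^ a - a * (z `^ a / z) * (z - z').
  by field; rewrite gt_eqF.
have : a * (t / M) `^ (a^-1 - 1) * (z - z') <= a * (z `^ a / z) * (z - z').
  by rewrite ler_wpM2r ?subr_ge0// ler_wpM2l// ltW.
by lra.
Qed.

End powR_concave.

(** * Tonelli's theorem on the triangle [0 < t <= s] *)

Section triangle.
Context {R : realType}.
Notation mu := (@lebesgue_measure R).
Implicit Types k d f g : R -> R.

Lemma lebesgue_Rintegral_subset (A B : set R) f : measurable A -> measurable B ->
  A `<=` B -> (forall t, B t -> 0 <= f t) -> mu.-integrable B (EFin \o f) ->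
  Rintegral mu A f <= Rintegral mu B f.
Proof.
move=> mA mB AB f0 iB; have iA : mu.-integrable A (EFin \o f) by apply: integrableS iB.
rewrite /Rintegral fine_le//.
- exact: (integrable_fin_num _ iA).
- exact: (integrable_fin_num _ iB).
- apply: ge0_subset_integral => //; first exact: (measurable_int _ iB).
Qed.

Lemma lebesgue_integralB (A : set R) f g : measurable A ->
  mu.-integrable A (EFin \o f) -> mu.-integrable A (EFin \o g) ->
  (\int[mu]_(t in A) (f t - g t)%:E)%E = (Rintegral mu A f - Rintegral mu A g)%:E.
Proof.
move=> mA jf jg; rewrite integralB_EFin// EFinB /Rintegral !fineK//.
- exact: (integrable_fin_num _ jg).
- exact: (integrable_fin_num _ jf).
Qed.

Lemma lebesgue_ge0_integralZ (A : set R) (r : R) f : measurable A ->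
  measurable_fun A f -> (forall t, 0 <= f t) -> 0 <= r ->
  (\int[mu]_(t in A) (r * f t)%:E = r%:E * \int[mu]_(t in A) (f t)%:E)%E.
Proof.
move=> mA mf f0 r0; under eq_integral do rewrite EFinM.
apply: ge0_integralZl_EFin => //; first by move=> t _; rewrite lee_fin.
exact/measurable_EFinP.
Qed.

Lemma lebesgue_ge0_le_integral (A : set R) f g : measurable A ->
  measurable_fun A f -> measurable_fun A g -> (forall t, A t -> 0 <= f t <= g t) ->
  (\int[mu]_(t in A) (f t)%:E <= \int[mu]_(t in A) (g t)%:E)%E.
Proof.
move=> mA mf mg fg; apply: ge0_le_integral => //.
- by move=> t At; rewrite lee_fin; case/andP: (fg t At).
- exact/measurable_EFinP.
- exact/measurable_EFinP.
- by move=> t At; rewrite lee_fin; case/andP: (fg t At).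
Qed.

Section tonelli.
Variables k d : R -> R.
Hypotheses (mk : measurable_fun setT k) (md : measurable_fun setT d).
Hypotheses (k0 : forall t, 0 <= k t) (d0 : forall t, 0 <= d t).

Let b (ts : R * R) := (0 < ts.1) && (ts.1 <= ts.2).
Let F (ts : R * R) := if b ts then k ts.1 * d ts.2 else 0.

Let F0 ts : 0 <= F ts. Proof. by rewrite /F; case: ifP => // _; rewrite mulr_ge0. Qed.

Let mF : measurable_fun setT (EFin \o F).
Proof.
apply/measurable_EFinP; apply: measurable_fun_ifT.
- apply: measurable_and.
    by apply: measurable_fun_ltr => //; exact: measurable_fst.
  by apply: measurable_fun_ler; [exact: measurable_fst|exact: measurable_snd].
- apply: measurable_funM.
    by apply: (@measurableT_comp _ _ _ _ _ _ k) => //; exact: measurable_fst.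
  by apply: (@measurableT_comp _ _ _ _ _ _ d) => //; exact: measurable_snd.
- exact: measurable_cst.
Qed.

Let inner_snd t : (\int[mu]_y (EFin \o F) (t, y) =
  ((fun t => (k t)%:E * \int[mu]_(s in `[t, +oo[) (d s)%:E) \_ `]0%R, +oo[) t)%E.
Proof.
rewrite patchE; case: ifPn => tH.
  have t0 : 0 < t by move: tH; rewrite inE/= in_itv/= andbT.
  rewrite -ge0_integralZl_EFin//; last 2 first.
    by move=> s _; rewrite lee_fin.
    exact/measurable_EFinP/measurable_funTS.
  rewrite [RHS]integral_mkcond; apply: eq_integral => s _.
  rewrite patchE mem_setE in_itv/= andbT /F /b/= t0/=.
  by case: ifP => // _; rewrite EFinM.
have t0 : (0 < t) = false.
  by move: tH; rewrite notin_setE/= in_itv/= andbT => /negP/negbTE.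
by rewrite integral0_eq// => s _; rewrite /F /b/= t0.
Qed.

Let inner_fst s : (\int[mu]_x (EFin \o F) (x, s) =
  ((fun s => (d s)%:E * \int[mu]_(t in `]0%R, s]) (k t)%:E) \_ `]0%R, +oo[) s)%E.
Proof.
rewrite patchE; case: ifPn => sH.
  rewrite -ge0_integralZl_EFin//; last 2 first.
    by move=> t _; rewrite lee_fin.
    exact/measurable_EFinP/measurable_funTS.
  rewrite [RHS]integral_mkcond; apply: eq_integral => t _.
  rewrite patchE mem_setE in_itv/= /F /b/=.
  by case: ifP => // _; rewrite mulrC EFinM.
have s0 : s <= 0.
  by move: sH; rewrite notin_setE/= in_itv/= andbT => /negP; rewrite -leNgt.
rewrite integral0_eq// => t _; rewrite /F /b/=.
by case: ifPn => // /andP[t0 ts]; move: (lt_le_trans t0 (le_trans ts s0)); rewrite ltxx.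
Qed.

(** Savings in cost accrue over [t], each instant counting all leaf removed beyond it. The exchange
    charges them to the position [s] of the removed leaf, where they can be compared pointwise with
    the light lost at [s]. *)
Lemma tonelli_triangle :
  (\int[mu]_(t in `]0%R, +oo[) ((k t)%:E * \int[mu]_(s in `[t, +oo[) (d s)%:E) =
   \int[mu]_(s in `]0%R, +oo[) ((d s)%:E * \int[mu]_(t in `]0%R, s]) (k t)%:E))%E.
Proof.
rewrite integral_mkcond [RHS]integral_mkcond.
have fub := @fubini_tonelli _ _ _ _ R mu mu (EFin \o F) mF (fun ts => F0 ts).
transitivity (\int[mu]_x \int[mu]_y (EFin \o F) (x, y))%E.
  by apply: eq_integral => t _; rewrite -inner_snd.
by rewrite fub; apply: eq_integral => s _; rewrite -inner_fst.
Qed.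

Lemma measurable_triangle : measurable_fun (`]0%R, +oo[%classic : set R)
  (fun s => (d s)%:E * \int[mu]_(t in `]0%R, s]) (k t)%:E)%E.
Proof.
have h := @measurable_fun_fubini_tonelli_G _ _ _ _ R mu (EFin \o F) mF (fun ts => F0 ts).
apply: (eq_measurable_fun (fubini_G mu (EFin \o F))).
  by move=> s sH; rewrite /fubini_G inner_fst patchE sH.
exact: measurable_funTS.
Qed.

End tonelli.

End triangle.

Section truncation.
Context {R : realType}.
Notation mu := (@lebesgue_measure R).
Variables (theta0 alpha c : R) (I : R -> R).
Hypothesis theta0_itv : 0 < theta0 < pi / 2.
Hypothesis alpha_itv : 0 < alpha < 1.
Hypothesis c_gt0 : 0 < c.
Hypothesis I_range : forall x, 0 <= x -> 0 <= I x <= 1.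
Hypothesis I_mono : forall x y, 0 <= x -> x <= y -> I x <= I y.
Implicit Types (p u phi : R -> R) (r s t x : R).

Let H : set R := `]0, +oo[%classic.
Let mH : measurable H. Proof. exact: measurable_itv. Qed.
Let s0 := sin theta0.

Let alpha_gt0 : 0 < alpha. Proof. by case/andP: alpha_itv. Qed.

(** Competitors before truncation: integrability of [u] takes the place of the envelope. *)
Definition wide_control p u : Prop :=
  [/\ measurable_fun setT p, measurable_fun setT u,
      (forall t, s0 <= p t <= 1), (forall t, 0 <= u t) &
      mu.-integrable setT (EFin \o u)].

Definition light_rate p u t : R := I (climb p t) * rate theta0 p u t.

Definition cost u t : R := c * zstate u t `^ alpha.

Definition total_payoff p u : \bar R :=
  (\int[mu]_(t in H) (light_rate p u t - cost u t)%:E)%E.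

Let int_sub u (A : set R) : measurable A -> mu.-integrable setT (EFin \o u) ->
  mu.-integrable A (EFin \o u).
Proof. by move=> mA; exact: integrableS. Qed.

Lemma cost_ge0 u t : 0 <= cost u t.
Proof. by apply: mulr_ge0; [exact: ltW|exact: powR_ge0]. Qed.

Lemma measurable_wide_cost p u : wide_control p u -> measurable_fun setT (cost u).
Proof.
move=> [mp mu_ bp u0 iu]; apply: (@measurable_cost _ _ _ u) => // t.
by rewrite u0 lexx.
Qed.

Lemma light_rate_bounds p u t : wide_control p u ->
  0 <= light_rate p u t <= Num.min (u t) 1.
Proof.
move=> [mp mu_ bp u0 iu]; have /andP[i0 i1] := I_range (climb_ge0 theta0_itv t bp).
have /andP[r0 r1] := rate_bounds theta0_itv (bp t) (u0 t).
have ru : rate theta0 p u t <= u t.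
  by apply/gain_le/width_gt0 => //; case/andP: (bp t).
rewrite /light_rate mulr_ge0//= le_min.
by rewrite !(le_trans (ler_piMl r0 i1)).
Qed.

Lemma measurable_light_rate p u : wide_control p u ->
  measurable_fun setT (light_rate p u).
Proof.
move=> [mp mu_ bp u0 iu]; apply: measurable_funM.
  exact: (measurable_light theta0_itv I_mono mp bp).
by apply: measurable_rate => // t _; case/andP: (bp t).
Qed.

Lemma integrable_light_rate p u : wide_control p u ->
  mu.-integrable H (EFin \o light_rate p u).
Proof.
move=> w; have [mp mu_ bp u0 iu] := w.
apply: (@lebesgue_le_integrable _ _ _ _ u) => //.
- by apply: measurable_funTS; exact: measurable_light_rate.
- move=> t _; have /andP[h1] := light_rate_bounds t w.
  by rewrite le_min => /andP[h2 _]; rewrite ger0_norm.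
- exact: int_sub.
Qed.

(** The positive part of the integrand is at most [u] and has a finite integral, so a nonnegative
    total excludes an infinite negative part. The cost is at most [u] plus that negative part. *)
Lemma integrable_wide_cost p u : wide_control p u -> (0 <= total_payoff p u)%E ->
  mu.-integrable H (EFin \o cost u).
Proof.
move=> w; have [mp mu_ bp u0 iu] := w; rewrite /total_payoff.
set f := fun t => (light_rate p u t - cost u t)%:E => f_ge0.
have mf : measurable_fun H f.
  apply/measurable_EFinP; apply: measurable_funTS.
  by apply: measurable_funB; [exact: measurable_light_rate|exact: measurable_wide_cost w].
have iuH : mu.-integrable H (EFin \o u) by exact: int_sub.
have muH : measurable_fun H (fun t => (u t)%:E) by exact: (measurable_int _ iuH).
have u_lty : (\int[mu]_(t in H) (u t)%:E < +oo)%E.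
  rewrite -ge0_fin_numE; first exact: (integrable_fin_num _ iuH).
  by apply: integral_ge0 => t _; rewrite lee_fin.
have pos_lty : (\int[mu]_(t in H) f^\+ t < +oo)%E.
  apply: le_lt_trans u_lty; apply: ge0_le_integral => //.
  - exact: measurable_funepos.
  - move=> t _; rewrite funeposE ge_max !lee_fin u0 andbT.
    have /andP[h1] := light_rate_bounds t w; rewrite le_min => /andP[h2 _].
    by rewrite lerBlDr ler_wpDr// cost_ge0.
have neg_lty : (\int[mu]_(t in H) f^\- t < +oo)%E.
  rewrite ltey; apply/eqP => neg_y; move: f_ge0; rewrite integralE neg_y.
  have : (\int[mu]_(t in H) f^\+ t \is a fin_num)%E.
    by rewrite ge0_fin_numE//; apply: integral_ge0.
  by move=> /fineK <-.
have ineg : mu.-integrable H (fun t => (u t)%:E + f^\- t)%E.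
  apply/integrableP; split.
    by apply: emeasurable_funD => //; exact: measurable_funeneg.
  under eq_integral.
    move=> t _; rewrite gee0_abs; last by apply: adde_ge0; rewrite ?lee_fin.
    over.
  rewrite ge0_integralD//; first by rewrite lte_add_pinfty.
    by move=> t _; rewrite lee_fin.
  exact: measurable_funeneg.
apply: le_integrable ineg => //.
  apply/measurable_EFinP; apply: measurable_funTS; exact: measurable_wide_cost w.
move=> t _ /=; rewrite ger0_norm ?cost_ge0// gee0_abs; last first.
  by apply: adde_ge0; rewrite ?lee_fin.
rewrite funenegE /f -EFinN; have /andP[h1] := light_rate_bounds t w.
rewrite le_min => /andP[h2 _].
apply: (@le_trans _ _ ((u t)%:E + (- (light_rate p u t - cost u t))%:E)%E).
  by rewrite -EFinD lee_fin opprB; lra.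
by apply: leeD => //; rewrite le_max lexx.
Qed.

Lemma total_payoffE p u : wide_control p u -> mu.-integrable H (EFin \o cost u) ->
  total_payoff p u =
  (Rintegral mu H (light_rate p u) - Rintegral mu H (cost u))%:E.
Proof.
move=> w ic; exact: (lebesgue_integralB mH (integrable_light_rate w) ic).
Qed.

Lemma cost_lower_bound u t r : mu.-integrable H (EFin \o cost u) -> 0 < t ->
  0 <= r -> (forall s, 0 < s <= t -> r <= cost u s) -> r * t <= Rintegral mu H (cost u).
Proof.
move=> ic t0 r0 hr; pose A : set R := `]0, t]%classic.
have AH : A `<=` H by move=> s; rewrite /A/H/= !in_itv/= andbT => /andP[].
have mA : measurable A by exact: measurable_itv.
have muA : mu A = t%:E by rewrite /A lebesgue_measure_itv/= lte_fin t0 sube0.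
apply: (@le_trans _ _ (Rintegral mu A (cost u))); last first.
  by apply: lebesgue_Rintegral_subset => // s _; exact: cost_ge0.
have <- : Rintegral mu A (cst r) = r * t.
  transitivity (r * fine (mu A)); last by rewrite muA.
  by apply: (@Rintegral_cst _ _ _ mu).
apply: lebesgue_le_Rintegral => //.
- apply: (@lebesgue_bounded_integrable _ _ _ _ r) => //; first by rewrite muA ltry.
  by move=> s _ /=; rewrite ger0_norm.
- exact: integrableS ic.
Qed.

(** The largest [A] with [c * (A/2)^(1+alpha) <= A], that is with [(A/2)^alpha <= 2/c]. *)
Definition cost_bound : R := 2 * (2 / c) `^ alpha^-1.

Lemma cost_bound_gt0 : 0 < cost_bound.
Proof. by rewrite mulr_gt0// powR_gt0// divr_gt0. Qed.

(* If [A] is the integral of [min u 1] then [z t >= A - t], so the cost exceeds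
   [c (A/2)^(1+alpha)], while the total gain is at most [A]. *)
Lemma cost_le_bound p u : wide_control p u -> (0 <= total_payoff p u)%E ->
  Rintegral mu H (cost u) <= cost_bound.
Proof.
move=> w pay0; have [mp mu_ bp u0 iu] := w.
have ic := integrable_wide_cost w pay0.
pose v t := Num.min (u t) 1.
have v0 t : 0 <= v t by rewrite le_min u0/=.
have mv : measurable_fun setT v by exact: measurable_minr.
have iv (A : set R) : measurable A -> mu.-integrable A (EFin \o v).
  move=> mA; apply: (@lebesgue_le_integrable _ _ mA _ u).
  - exact: measurable_funTS.
  - by move=> t _; rewrite ger0_norm// ge_min lexx.
  - exact: int_sub.
pose A := Rintegral mu H v.
have costA : Rintegral mu H (cost u) <= A.
  move: pay0; rewrite total_payoffE// lee_fin subr_ge0 => /le_trans; apply.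
  apply: lebesgue_le_Rintegral => //; [exact: integrable_light_rate|exact: iv|].
  by move=> t _; have /andP[] := light_rate_bounds t w.
have zA t : 0 < t -> A - t <= zstate u t.
  move=> t0; apply: (@le_trans _ _ (zstate v t)); last first.
    apply: lebesgue_le_Rintegral => //; [exact: iv|exact: int_sub|].
    by move=> s _; rewrite ge_min lexx.
  have iH : mu.-integrable H (EFin \o v) by exact: iv.
  rewrite /zstate -Rintegral_itv_obnd_cbnd; last exact: iv.
  rewrite -(@Rintegral_itvB _ v (BRight 0) +oo%O t)//; last by rewrite bnd_simp ltW.
  rewrite lerD2l lerN2.
  have mut : mu `]0, t]%classic = t%:E by rewrite lebesgue_measure_itv/= lte_fin t0 sube0.
  have E : Rintegral mu `]0, t]%classic (cst 1) = t.
    transitivity (1 * fine (mu `]0, t]%classic)); last by rewrite mut mul1r.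
    by apply: (@Rintegral_cst _ _ _ mu).
  rewrite -[leRHS]E; apply: lebesgue_le_Rintegral => //; first exact: iv.
    apply: (@lebesgue_bounded_integrable _ _ _ _ 1) => //; first by rewrite mut ltry.
    by move=> s _ /=; rewrite normr1.
  by move=> s _; rewrite ge_min lexx orbT.
apply: (le_trans costA); have [A0|A0] := leP A 0.
  exact: (le_trans A0 (ltW cost_bound_gt0)).
have A2 : 0 < A / 2 by rewrite divr_gt0.
have : c * (A / 2) `^ alpha * (A / 2) <= A.
  apply: le_trans costA; apply: (cost_lower_bound ic A2).
    by apply: mulr_ge0; [exact: ltW|exact: powR_ge0].
  move=> s /andP[s_gt0 sA]; rewrite /cost (ler_pM2l c_gt0).
  have hz : A / 2 <= zstate u s by have := zA _ s_gt0; lra.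
  by apply: ge0_ler_powR; rewrite ?nnegrE ?(ltW alpha_gt0) ?(ltW A2)// (le_trans (ltW A2)).
rewrite mulrA ler_pdivrMr// [A * 2]mulrC ler_pM2r// mulrC -ler_pdivlMr// => h.
rewrite /cost_bound -ler_pdivrMl// mulrC.
have -> : A / 2 = ((A / 2) `^ alpha) `^ alpha^-1.
  by rewrite -powRrM mulfV ?gt_eqF// powRr1// ltW.
by apply: ge0_ler_powR; rewrite ?nnegrE ?invr_ge0 ?powR_ge0 ?(ltW alpha_gt0)// divr_ge0// ltW.
Qed.

(** The cost is nonincreasing in time, so [t] times its value at [t] is at most its integral. *)
Lemma zstate_powR_le p u t : wide_control p u -> (0 <= total_payoff p u)%E -> 0 < t ->
  zstate u t `^ alpha <= cost_bound / c / t.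
Proof.
move=> w pay0 t0; have [mp mu_ bp u0 iu] := w.
have ic := integrable_wide_cost w pay0.
rewrite ler_pdivlMr// ler_pdivlMr// mulrC mulrA.
apply: le_trans (cost_le_bound w pay0).
apply: (cost_lower_bound ic t0 (cost_ge0 u t)).
move=> s /andP[s_gt0 st]; rewrite /cost (ler_pM2l c_gt0).
(* [u] serves as its own integrable envelope, which makes the lemmas on controls below an envelope
   available. *)
have bu r : 0 <= u r <= u r by rewrite u0 lexx.
have zt : 0 <= zstate u t by case/andP: (zstate_bounds mu_ u0 iu t mu_ bu).
have zst : zstate u t <= zstate u s by exact: (zstate_le iu mu_ bu st).
by apply: ge0_ler_powR; rewrite ?nnegrE ?(ltW alpha_gt0)// (le_trans zt).
Qed.

Definition truncate u phi t : R := Num.min (u t) (phi t).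

(* Cutting [u] at [phi] loses at most [exp(-phi)] units of light per unit of
   excess leaf, whereas one unit of leaf at [s] costs at least
   [c alpha int_0^s z^(alpha-1)], with [z] bounded by [zstate_powR_le]. *)
Lemma truncation_improves p u phi : wide_control p u -> (0 <= total_payoff p u)%E ->
  measurable_fun setT phi -> (forall t, 0 <= phi t) ->
  (forall s, 0 < s -> expR (- phi s) <=
    c * alpha * (s / 2 * (s / 2 / (cost_bound / c)) `^ (alpha^-1 - 1))) ->
  wide_control p (truncate u phi) /\
  (total_payoff p u <= total_payoff p (truncate u phi))%E.
Proof.
have swap (x y z r : R) : x - y <= z - r -> x - z <= y - r by lra.
move=> w pay0 mphi phi0 hphi; have [mp mu_ bp u0 iu] := w.
set v := truncate u phi; set M := cost_bound / c in hphi *.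
have M0 : 0 < M by rewrite divr_gt0// cost_bound_gt0.
have zM t : 0 < t -> zstate u t `^ alpha <= M / t by exact: zstate_powR_le w pay0.
clearbody M.
have v0 t : 0 <= v t by rewrite /v /truncate le_min u0 phi0.
have vu t : v t <= u t by rewrite /v /truncate ge_min lexx.
have vuE t : u t <= phi t -> v t = u t by exact: min_l.
have vphiE t : phi t <= u t -> v t = phi t by exact: min_r.
have mv : measurable_fun setT v by exact: measurable_minr.
clearbody v.
have iv : mu.-integrable setT (EFin \o v).
  apply: (@lebesgue_le_integrable _ _ _ _ u) => //.
  by move=> t _; rewrite ger0_norm.
have wv : wide_control p v by [].
split; first exact: wv.
have iC := integrable_wide_cost w pay0.
have bu t : 0 <= u t <= u t by rewrite u0 lexx.
have bv t : 0 <= v t <= v t by rewrite v0 lexx.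
pose d t := u t - v t.
have d0 t : 0 <= d t by rewrite subr_ge0.
have md : measurable_fun setT d by exact: measurable_funB.
have iu' (A : set R) : measurable A -> mu.-integrable A (EFin \o u) by move=> mA; exact: int_sub.
have iv' (A : set R) : measurable A -> mu.-integrable A (EFin \o v) by move=> mA; exact: int_sub.
have id (A : set R) : measurable A -> mu.-integrable A (EFin \o d).
  by move=> mA; apply: lebesgue_integrableB => //; [exact: iu'|exact: iv'].
have Dz t : (\int[mu]_(s in `[t, +oo[) (d s)%:E)%E = (zstate u t - zstate v t)%:E.
  have tm : measurable (`[t, +oo[%classic : set R) by exact: measurable_itv.
  rewrite integralB_EFin//; [|exact: iu'|exact: iv'].
  rewrite EFinB /zstate /Rintegral !fineK//.
  - exact: (integrable_fin_num _ (iv' _ tm)).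
  - exact: (integrable_fin_num _ (iu' _ tm)).
have z0 t : 0 <= zstate v t by case/andP: (zstate_bounds mv v0 iv t mv bv).
have zvu t : zstate v t <= zstate u t.
  by apply: lebesgue_le_Rintegral => //; [exact: iv'|exact: iu'].
have mcv := measurable_wide_cost wv; have mcu := measurable_wide_cost w.
have cvu t : cost v t <= cost u t.
  rewrite /cost (ler_pM2l c_gt0).
  by apply: ge0_ler_powR; rewrite ?nnegrE ?(ltW alpha_gt0)// (le_trans (z0 t)).
have iCv : mu.-integrable H (EFin \o cost v).
  apply: (lebesgue_le_integrable mH (measurable_funTS mcv) _ iC).
  by move=> t _; rewrite ger0_norm// cost_ge0.
pose k t := (t / M) `^ (alpha^-1 - 1).
have k0 t : 0 <= k t by exact: powR_ge0.
have mk : measurable_fun setT k.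
  apply: (@measurableT_comp _ _ _ _ _ _ (@powR R ^~ (alpha^-1 - 1))).
    exact: measurable_powR.
  exact: measurable_funM.
have b1 : 0 <= alpha^-1 - 1 by rewrite subr_ge0 invf_ge1// ltW//; case/andP: alpha_itv.
have knd s t : 0 <= s -> s <= t -> k s <= k t.
  move=> s_ge0 st; apply: ge0_ler_powR => //; rewrite ?nnegrE ?divr_ge0 ?(ltW M0)//.
    exact: le_trans st.
  by rewrite ler_pM2r// invr_gt0.
have ca0 : 0 <= c * alpha by rewrite mulr_ge0 ?ltW.
(* Concavity of the power, applied at each [t] to the two masses, whose difference is the integral
   of [d] over [[t, +oo[]. *)
have saved : ((c * alpha)%:E *
    \int[mu]_(t in H) ((k t)%:E * \int[mu]_(s in `[t, +oo[) (d s)%:E) <=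
    \int[mu]_(t in H) (cost u t - cost v t)%:E)%E.
  pose e t := k t * (zstate u t - zstate v t).
  have kDz t : ((k t)%:E * \int[mu]_(s in `[t, +oo[) (d s)%:E = (e t)%:E)%E.
    by rewrite Dz -EFinM.
  have me : measurable_fun setT e.
    apply: measurable_funM => //; apply: measurable_funB.
      by apply: nonincreasing_measurable => // x y; exact: (zstate_le iu mu_ bu).
    by apply: nonincreasing_measurable => // x y; exact: (zstate_le iv mv bv).
  have e0 t : 0 <= e t by rewrite mulr_ge0// subr_ge0.
  have ecost t : 0 < t -> c * alpha * e t <= cost u t - cost v t.
    move=> t0; rewrite /cost -mulrBr -mulrA (ler_pM2l c_gt0) mulrA.
    apply: powR_diff_ge => //; first by rewrite z0 zvu.
    exact: zM.
  clearbody e; under eq_integral do rewrite kDz.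
  rewrite -(lebesgue_ge0_integralZ mH (measurable_funTS me) e0 ca0).
  apply: (lebesgue_ge0_le_integral mH).
  - by apply: measurable_funTS; exact: measurable_funM.
  - exact: (measurable_funTS (measurable_funB mcu mcv)).
  move=> t; rewrite /H/= in_itv/= andbT => t0.
  by rewrite ecost// andbT mulr_ge0.
have lost s : 0 < s -> light_rate p u s - light_rate p v s <=
    c * alpha * (d s * (s / 2 * k (s / 2))).
  move=> s_gt0; have /andP[i0 i1] := I_range (climb_ge0 theta0_itv s bp).
  have wp : 0 < width theta0 (p s) by apply: width_gt0 => //; case/andP: (bp s).
  have w1 : width theta0 (p s) <= 1 by exact: width_le1.
  rewrite /light_rate -mulrBr.
  have g0 : 0 <= rate theta0 p u s - rate theta0 p v s.
    by rewrite subr_ge0; exact: le_gain_r.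
  apply: (le_trans (ler_piMl g0 i1)).
  apply: (@le_trans _ _ (expR (- v s) * (u s - v s))).
    by apply: gain_lipschitz; apply/andP.
  rewrite -/(d s) [d s * _]mulrC mulrA.
  (* Where [u <= phi] nothing is cut; elsewhere [v = phi] and the slope [exp (- v)] is the one that
     [hphi] controls. *)
  have [us|us] := leP (u s) (phi s).
    by rewrite /d (vuE _ us) subrr !mulr0.
  apply: ler_wpM2r => //; rewrite (vphiE _ (ltW us)).
  exact: hphi.
have lostI : (\int[mu]_(s in H) (light_rate p u s - light_rate p v s)%:E <=
    (c * alpha)%:E *
    \int[mu]_(s in H) ((d s)%:E * \int[mu]_(t in `]0%R, s]) (k t)%:E))%E.
  have mtri := measurable_triangle mk md k0 d0.
  have int0 s : (0 <= \int[mu]_(t in `]0%R, s]) (k t)%:E)%E.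
    by apply: integral_ge0 => t _; rewrite lee_fin.
  have tri0 s : (0 <= (d s)%:E * \int[mu]_(t in `]0%R, s]) (k t)%:E)%E.
    by apply: mule_ge0 => //; rewrite lee_fin.
  rewrite -ge0_integralZl_EFin//.
  apply: ge0_le_integral => //.
  - move=> s _; rewrite lee_fin /light_rate -mulrBr.
    have /andP[i0 _] := I_range (climb_ge0 theta0_itv s bp).
    rewrite mulr_ge0// subr_ge0; apply: le_gain_r => //.
    by apply: width_gt0 => //; case/andP: (bp s).
  - apply/measurable_EFinP.
    exact: (measurable_funTS (measurable_funB (measurable_light_rate w)
                                              (measurable_light_rate wv))).
  - by apply: measurable_funeM.
  move=> s; rewrite /H/= in_itv/= andbT => s_gt0.
  apply: (@le_trans _ _ ((c * alpha * (d s * (s / 2 * k (s / 2))))%:E)).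
    by rewrite lee_fin; exact: lost.
  rewrite EFinM; apply: lee_wpmul2l; first by rewrite lee_fin.
  rewrite EFinM; apply: lee_wpmul2l; first by rewrite lee_fin.
  have s2 : s / 2 < s by lra.
  have s20 : 0 <= s / 2 by lra.
  (* On the upper half of []0, s]] the weight [k] is at least [k (s / 2)]. This bound of the inner
     integral is the origin of the factors [s / 2] in the assumption on [phi]. *)
  pose B : set R := `](s / 2), s]%classic.
  have mB : measurable B by exact: measurable_itv.
  have muB : mu B = (s / 2)%:E.
    by rewrite /B lebesgue_measure_itv/= lte_fin s2 -EFinB; congr (_%:E); lra.
  apply: (@le_trans _ _ (\int[mu]_(t in B) (k (s / 2))%:E)%E).
    have -> : (\int[mu]_(t in B) (k (s / 2))%:E = (k (s / 2))%:E * mu B)%E.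
      by apply: (@integral_cst _ _ _ mu).
    by rewrite muB -EFinM mulrC.
  apply: (@le_trans _ _ (\int[mu]_(t in B) (k t)%:E)%E).
    apply: ge0_le_integral => //.
    - by move=> t _; rewrite lee_fin.
    - exact/measurable_EFinP/measurable_funTS.
    - by move=> t; rewrite /B/= in_itv/= => /andP[/ltW st _]; rewrite lee_fin; exact: knd.
  apply: ge0_subset_integral => //.
  - exact/measurable_EFinP/measurable_funTS.
  - by move=> t _; rewrite lee_fin.
  - by move=> t; rewrite /B/= !in_itv/= => /andP[st ->]; rewrite (le_lt_trans s20).
rewrite (tonelli_triangle mk md k0 d0) in saved.
have := le_trans lostI saved.
rewrite (lebesgue_integralB mH (integrable_light_rate w) (integrable_light_rate wv)).
rewrite (lebesgue_integralB mH iC iCv) (total_payoffE w iC) (total_payoffE wv iCv).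
rewrite !lee_fin; exact: swap.
Qed.

End truncation.

(** * A uniform envelope *)

Section logarithmic_envelope.
Context {R : realType}.
Notation mu := (@lebesgue_measure R).
Variables (b T : R).
Hypotheses (b_gt0 : 0 < b) (T_gt0 : 0 < T).
Implicit Types a s x : R.

Let g s : R := b * (ln T - ln s).
(** An antiderivative of [g], nonnegative on []0, T]] with [F T = b * T]: hence the bound [b * T]
    for the integral of [g] over any [[a, T]]. *)
Let F s : R := b * (s * (ln T - ln s) + s).

Definition envelope (s : R) : R := if (0 < s) && (s <= T) then g s else 0.

Let g_ge0 s : 0 < s -> s <= T -> 0 <= g s.
Proof. by move=> s0 sT; rewrite mulr_ge0 ?(ltW b_gt0)// subr_ge0 ler_ln. Qed.

Lemma envelope_ge0 s : 0 <= envelope s.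
Proof. by rewrite /envelope; case: ifP => // /andP[]; exact: g_ge0. Qed.

Lemma envelope_eq0 s : ~ `[0, T]%classic s -> envelope s = 0.
Proof.
by rewrite /envelope /= in_itv/=; case: ifP => // /andP[/ltW -> ->].
Qed.

Let measurable_g : measurable_fun setT g.
Proof. by apply: measurable_funM => //; apply: measurable_funB => //; exact: measurable_ln. Qed.

Lemma measurable_envelope : measurable_fun setT envelope.
Proof.
apply: measurable_fun_ifT => //; apply: measurable_and.
  by apply: measurable_fun_ltr => //; exact: measurable_id.
by apply: measurable_fun_ler => //; exact: measurable_id.
Qed.

(** Equality holds up to [T]; beyond it the envelope is 0 and the right side exceeds 1. *)
Lemma expR_envelope s : 0 < s -> expR (- envelope s) <= (s / T) `^ b.
Proof.
move=> s0; rewrite /envelope s0/=; case: (leP s T) => sT.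
  rewrite /powR gt_eqF ?divr_gt0//= ler_expR /g lnM ?posrE ?invr_gt0// lnV ?posrE//.
  by lra.
rewrite oppr0 expR0; apply: (@le_trans _ _ (1 `^ b)); first by rewrite powR1.
apply: ge0_ler_powR; rewrite ?nnegrE ?(ltW b_gt0)//.
- by rewrite divr_ge0 ?ltW.
- by rewrite ler_pdivlMr// mul1r ltW.
Qed.

Let is_derive_F s : 0 < s -> is_derive s 1 F (g s).
Proof.
move=> s0; have dl := is_derive1_ln s0.
rewrite /F; apply: is_derive_eq.
by rewrite /g /GRing.scale/=; field; rewrite gt_eqF.
Qed.

Let integral_g a : 0 < a -> a < T -> (\int[mu]_(s in `[a, T]) (g s)%:E <= (b * T)%:E)%E.
Proof.
move=> a0 aT.
have cF x : 0 < x -> {for x, continuous F}.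
  move=> x0; apply: differentiable_continuous; apply/derivable1_diffP.
  by have [] := is_derive_F x0.
rewrite (@continuous_FTC2 _ g F)//.
- rewrite -EFinB lee_fin /F subrr mulr0 add0r lerBlDr lerDl.
  rewrite mulr_ge0 ?(ltW b_gt0)// addr_ge0 ?(ltW a0)// mulr_ge0 ?(ltW a0)//.
  by rewrite subr_ge0 ler_ln ?posrE// ltW.
- apply: continuous_in_subspaceT => x; rewrite inE/= in_itv/= => /andP[ax _].
  apply: cvgM; first exact: cvg_cst.
  apply: cvgB; first exact: cvg_cst.
  by apply: continuous_ln; exact: lt_le_trans ax.
- split.
  + by move=> x; rewrite in_itv/= => /andP[ax _]; have [] := is_derive_F (lt_trans a0 ax).
  + by apply: cvg_at_right_filter; exact: cF.
  + by apply: cvg_at_left_filter; exact: cF.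
- move=> x; rewrite in_itv/= => /andP[ax _]; rewrite derive1E.
  by have [_ ->] := is_derive_F (lt_trans a0 ax).
Qed.

Lemma integrable_envelope : mu.-integrable setT (EFin \o envelope).
Proof.
apply/integrableP; split; first by apply/measurable_EFinP; exact: measurable_envelope.
apply: (@le_lt_trans _ _ (b * T)%:E); last exact: ltry.
(* Exhaustion of []0, T]] away from the logarithmic singularity; the denominator [n + 2] puts the
   left end strictly below [T] already for [n = 0]. Monotone convergence then transfers the
   bound. *)
pose A n : set R := `[T / n.+2%:R, T]%classic.
have n2 n : 0 < n.+2%:R :> R by rewrite ltr0n.
have AE : \bigcup_n A n = `]0, T]%classic.
  apply/seteqP; split=> [s [n _]|s]; rewrite /A/= !in_itv/= => /andP[h1 h2].
    by rewrite h2 andbT (lt_le_trans _ h1)// divr_gt0.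
  exists (Num.truncn (T / s)); first by [].
  rewrite /= in_itv/= h2 andbT ler_pdivrMr// mulrC -ler_pdivrMr//.
  apply: ltW; apply: (lt_trans (truncnS_gt _)); by rewrite ltr_nat.
have -> : (\int[mu]_x `|(EFin \o envelope) x| = \int[mu]_(s in \bigcup_n A n) (g s)%:E)%E.
  rewrite AE [RHS]integral_mkcond; apply: eq_integral => s _.
  rewrite patchE mem_setE in_itv/= ger0_norm ?envelope_ge0// /envelope.
  by case: ifP.
have mA n : measurable (A n) by exact: measurable_itv.
have cv : (\int[mu]_(s in A n) (g s)%:E)%E @[n --> \oo] -->
    (\int[mu]_(s in \bigcup_n A n) (g s)%:E)%E.
  apply: ge0_nondecreasing_set_cvg_integral => //.
  - move=> m n mn; apply/subsetPset => s; rewrite /A/= !in_itv/= => /andP[h ->].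
    rewrite andbT (le_trans _ h)// ler_pM2l// lef_pV2 ?posrE//.
    by rewrite ler_nat !ltnS.
  - by move=> n; apply/measurable_EFinP/measurable_funTS.
  - move=> n s; rewrite /A/= in_itv/= => /andP[h1 h2]; rewrite lee_fin g_ge0//.
    by rewrite (lt_le_trans _ h1)// divr_gt0.
rewrite -(cvg_lim (@ereal_hausdorff R) cv); apply: lime_le; first exact: cvgP cv.
apply: nearW => n; apply: integral_g; first by rewrite divr_gt0.
by rewrite ltr_pdivrMr// ltr_pMr// ltr1n.
Qed.

End logarithmic_envelope.

(** * Existence *)

Section optimal_stem.
Context {R : realType}.
Notation mu := (@lebesgue_measure R).
Variables (theta0 alpha c : R) (I : R -> R).
Hypothesis theta0_itv : 0 < theta0 < pi / 2.
Hypothesis alpha_itv : 0 < alpha < 1.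
Hypothesis c_gt0 : 0 < c.
Hypothesis I_range : forall x, 0 <= x -> 0 <= I x <= 1.
Hypothesis I_mono : forall x y, 0 <= x -> x <= y -> I x <= I y.
Implicit Types (p u th phi : R -> R) (r s t x : R).

Let H : set R := `]0, +oo[%classic.
Let mH : measurable H. Proof. exact: measurable_itv. Qed.
Let s0 := sin theta0.
Let alpha_gt0 : 0 < alpha. Proof. by case/andP: alpha_itv. Qed.

Let ler_sin : {in `[(- (pi / 2)), pi / 2] &, {mono (@sin R) : x y / x <= y}}.
Proof. by apply: le_mono_in => x y hx hy; rewrite ltr_sin. Qed.

Let angle_itv x : theta0 <= x <= pi / 2 -> x \in `[(- (pi / 2)), pi / 2].
Proof.
move=> /andP[h1 h2]; rewrite in_itv/= h2 andbT.
by case/andP: theta0_itv => h3 h4; lra.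
Qed.

Let theta0_in : theta0 <= theta0 <= pi / 2.
Proof. by rewrite lexx ltW//; case/andP: theta0_itv. Qed.

Let sin_bounds x : theta0 <= x <= pi / 2 -> s0 <= sin x <= 1.
Proof.
move=> h; rewrite sin_le1 andbT ler_sin ?angle_itv//.
by case/andP: h.
Qed.

Let s0_gt0 : 0 < s0.
Proof.
by apply: sin_gt0_pi; case/andP: theta0_itv => -> h/=; have := pi_gt0 R; lra.
Qed.

Let itv1 x : s0 <= x <= 1 -> x \in `[(-1), 1].
Proof. by move=> /andP[h1 h2]; rewrite in_itv/= h2 andbT; have := s0_gt0; lra. Qed.

Let asin_itv x : -1 <= x <= 1 -> asin x \in `[(- (pi / 2)), pi / 2].
Proof. by move=> h; rewrite in_itv/= asin_geNpi2// asin_lepi2. Qed.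

Let asin_bounds x : s0 <= x <= 1 -> theta0 <= asin x <= pi / 2.
Proof.
move=> h; have h1 := itv1 h; have h2 : -1 <= x <= 1 by rewrite in_itv in h1.
have -> : (theta0 <= asin x) = (sin theta0 <= sin (asin x)).
  by apply/esym/ler_sin; [exact: angle_itv|exact: asin_itv].
by rewrite asinK// asin_lepi2// andbT; case/andP: h.
Qed.

(** Clamping its argument to [[-1, 1]] turns [asin] into a monotone, hence measurable, function on
    the whole line. *)
Let measurable_asin (A : set R) p : measurable A -> measurable_fun A p ->
  (forall t, s0 <= p t <= 1) -> measurable_fun A (fun t => asin (p t)).
Proof.
move=> mA mp bp; pose a x := asin (Num.max (-1) (Num.min 1 x)).
have clamp x : -1 <= Num.max (-1) (Num.min 1 x) <= 1.
  by rewrite le_max lexx/= ge_max ge_min lexx/= andbT; lra.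
have na : nondecreasing_fun a.
  move=> x y xy; rewrite -ler_sin ?asin_itv// !asinK ?in_itv/= ?clamp//.
  have mxy : Num.min 1 x <= Num.min 1 y by rewrite le_min !ge_min lexx xy orbT.
  by rewrite ge_max !le_max lexx/= mxy orbT.
apply: (eq_measurable_fun (fun t => a (p t))).
  move=> t _; have /andP[h1 h2] := bp t.
  rewrite /a min_r// max_r//; have := s0_gt0; lra.
apply: (@measurableT_comp _ _ _ _ _ _ a) => //.
exact: nondecreasing_measurable.
Qed.

(** [climb] reads times in [[0, t]] and [zstate] times from [t > 0] on, so agreement there is
    enough; the two domains of integration differ by the null set of the point 0. *)
Lemma Jfun_total_payoff th u p v : (forall t, 0 <= t -> theta0 <= th t <= pi / 2) ->
  (forall t, 0 <= t -> p t = sin (th t)) -> (forall t, 0 < t -> v t = u t) ->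
  wide_control theta0 p v ->
  Jfun theta0 alpha c I th u = total_payoff theta0 alpha c I p v.
Proof.
move=> bth pth vu w.
have E t : t \in H -> (light_rate theta0 I p v t - cost alpha c v t)%:E =
    (I (height th t) * Gfun theta0 (th t) (u t) - c * zstate u t `^ alpha)%:E.
  rewrite /H mem_setE in_itv/= andbT => t0; have t0' := ltW t0.
  have -> : height th t = climb p t.
    apply: eq_Rintegral => s; rewrite inE/= in_itv/= => /andP[s_ge0 _].
    by rewrite pth.
  have -> : zstate u t = zstate v t.
    apply: eq_Rintegral => s; rewrite inE/= in_itv/= andbT => ts.
    by rewrite vu// (lt_le_trans t0).
  congr (_ * _ - _)%:E; rewrite /rate pth// width_sin//; last exact: bth.
  by rewrite vu.
have mf : measurable_fun H (fun t => (light_rate theta0 I p v t - cost alpha c v t)%:E).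
  apply/measurable_EFinP.
  exact: (measurable_funTS (measurable_funB
    (measurable_light_rate theta0_itv I_mono w) (measurable_wide_cost alpha c w))).
rewrite /Jfun /halfline -integral_itv_obnd_cbnd.
  by apply: eq_integral => t tH; exact/esym/E.
exact: eq_measurable_fun mf.
Qed.

(** Negative times are filled with [p = 1] and no leaves, which gives functions measurable on the
    whole line. *)
Lemma admissible_wide th u : admissible theta0 th u -> exists p v,
  [/\ forall t, 0 <= t -> p t = sin (th t), forall t, 0 < t -> v t = u t
    & wide_control theta0 p v].
Proof.
move=> [mth bth u0 iu].
have mhl : measurable (@halfline R) by exact: measurable_itv.
pose p t := if 0 <= t then sin ((th \_ (@halfline R)) t) else 1.
have pE t : 0 <= t -> p t = sin (th t).
  by move=> t0; rewrite /p t0 patchE mem_setE in_itv/= t0.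
have iuH : mu.-integrable H (EFin \o u).
  apply: integrableS iu => // t; rewrite /H /halfline/= !in_itv/= !andbT; exact: ltW.
exists p, (u \_ H); split => //.
- by move=> t t0; rewrite patchE mem_setE in_itv/= t0.
split.
- apply: measurable_fun_ifT => //.
    by apply: measurable_fun_ler => //; exact: measurable_id.
  apply: (@measurableT_comp _ _ _ _ _ _ (@sin R)).
    by apply: continuous_measurable_fun; exact: continuous_sin.
  exact/(measurable_restrictT _ mhl).
- apply/(measurable_restrictT _ mH)/measurable_EFinP.
  exact: (measurable_int _ iuH).
- move=> t; rewrite /p; case: ifPn => t0; last by rewrite lexx andbT sin_le1.
  by apply: sin_bounds; rewrite patchE mem_setE in_itv/= t0; exact: bth.
- move=> t; rewrite patchE mem_setE in_itv/= andbT; case: ifPn => // t0.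
  exact/u0/ltW.
- rewrite -restrict_EFin; apply/integrable_restrict => //.
  by rewrite setTI.
Qed.

Lemma control_admissible phi p u : mu.-integrable setT (EFin \o phi) ->
  control theta0 phi p u -> wide_control theta0 p u /\
  admissible theta0 (fun t => asin (p t)) u.
Proof.
move=> iphi [mp mu_ bp bu].
have iu : mu.-integrable setT (EFin \o u) by exact: (integrable_control iphi).
have u0 t : 0 <= u t by case/andP: (bu t).
split; first by split.
split.
- by apply: measurable_asin => //; [exact: measurable_itv|exact: measurable_funTS].
- by move=> t _; exact: asin_bounds.
- by move=> t _; exact: u0.
- by apply: integrableS iu => //; exact: measurable_itv.
Qed.

(** Beyond [T] the envelope leaves neither density nor remaining mass, so gain and cost both vanish
    there. *)
Lemma total_payoff_control T phi p u : 0 < T -> measurable_fun setT phi ->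
  (forall t, 0 <= phi t) -> (forall t, ~ `[0, T]%classic t -> phi t = 0) ->
  mu.-integrable setT (EFin \o phi) -> control theta0 phi p u ->
  total_payoff theta0 alpha c I p u = (payoff theta0 alpha c T I p u)%:E.
Proof.
move=> T0 mphi phi0 phiE iphi cpu; have [mp mu_ bp bu] := cpu.
have [w _] := control_admissible iphi cpu.
pose f t := light_rate theta0 I p u t - cost alpha c u t.
have mf : measurable_fun setT f.
  exact: (measurable_funB (measurable_light_rate theta0_itv I_mono w)
    (measurable_wide_cost alpha c w)).
have u_eq0 t : T < t -> u t = 0.
  move=> Tt; have := bu t; rewrite phiE; first lra.
  by rewrite /= in_itv/= => /andP[_]; rewrite leNgt Tt.
have fE t : T < t -> f t = 0.
  move=> Tt; rewrite /f /light_rate /rate u_eq0// gain0 mulr0 /cost.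
  have -> : zstate u t = 0.
    rewrite /zstate /Rintegral integral0_eq// => s.
    by rewrite /= in_itv/= andbT => ts; rewrite u_eq0// (lt_le_trans Tt).
  by rewrite powR0 ?gt_eqF// mulr0 subrr.
have mD : measurable (`[0, T]%classic : set R) by exact: measurable_itv.
have ipay : mu.-integrable `[0, T]%classic (EFin \o f).
  apply: (lebesgue_integrableB mD).
    apply: (integrable_weighted_rate theta0_itv T0 cpu).
      by apply: measurable_funTS; exact: (measurable_light theta0_itv I_mono mp bp).
    by move=> t _; apply: I_range; exact: (climb_ge0 theta0_itv).
  exact: (integrable_cost alpha_gt0 c_gt0 T0 mphi phi0 iphi mu_ bu).
have -> : payoff theta0 alpha c T I p u = Rintegral mu `[0, T]%classic f by [].
have fin : (\int[mu]_(x in `[0%R, T]) (f x)%:E)%E \is a fin_num.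
  by apply: (integrable_fin_num _ ipay).
rewrite /Rintegral (fineK fin).
rewrite -integral_itv_obnd_cbnd; last first.
  by apply/measurable_EFinP; exact: (measurable_funTS mf).
rewrite /total_payoff integral_mkcond [RHS]integral_mkcond; apply: eq_integral => t _.
rewrite !patchE !mem_setE !in_itv/= andbT.
by case: (ltP 0 t) => //= t0; case: (leP t T) => // /fE fT; rewrite -/(f t) fT.
Qed.

(** The right side is homogeneous of degree [1/alpha] in [s], namely [L * s^(1/alpha)];
    [T = L^(- alpha)] absorbs the constant. *)
Lemma stem_envelope : exists2 T, 0 < T & forall s, 0 < s -> (s / T) `^ alpha^-1 =
  c * alpha * (s / 2 * (s / 2 / (cost_bound alpha c / c)) `^ (alpha^-1 - 1)).
Proof.
set M := cost_bound alpha c / c.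
have M0 : 0 < M by rewrite divr_gt0// cost_bound_gt0.
clearbody M; pose L := c * alpha / 2 * (2 * M)^-1 `^ (alpha^-1 - 1).
have L0 : 0 < L by rewrite mulr_gt0 ?powR_gt0 ?invr_gt0 ?divr_gt0 ?mulr_gt0.
exists (L `^ alpha)^-1; first by rewrite invr_gt0 powR_gt0.
move=> s s_gt0; have s_ge0 := ltW s_gt0.
rewrite invrK powRM ?powR_ge0// -powRrM mulfV ?gt_eqF// powRr1 ?(ltW L0)//.
have -> : s / 2 / M = s * (2 * M)^-1 by field; rewrite gt_eqF.
rewrite powRM ?invr_ge0 ?mulr_ge0 ?(ltW M0)//.
have -> : s `^ alpha^-1 = s * s `^ (alpha^-1 - 1).
  rewrite -[X in X * _]powRr1// -powRD ?(gt_eqF s_gt0) ?implybT//.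
  by congr (_ `^ _); ring.
by rewrite /L; ring.
Qed.

Theorem optimal_exists : exists th u, optimal theta0 alpha c I th u.
Proof.
have [T T0 TE] := stem_envelope.
have b0 : 0 < alpha^-1 by rewrite invr_gt0.
pose phi := envelope alpha^-1 T.
have mphi : measurable_fun setT phi by exact: measurable_envelope.
have phi0 t : 0 <= phi t by exact: envelope_ge0.
have phiE := @envelope_eq0 R alpha^-1 T.
have iphi : mu.-integrable setT (EFin \o phi) by exact: integrable_envelope.
have phi_exp s : 0 < s -> expR (- phi s) <=
    c * alpha * (s / 2 * (s / 2 / (cost_bound alpha c / c)) `^ (alpha^-1 - 1)).
  by move=> s_gt0; rewrite -TE//; exact: expR_envelope.
have [p [u [cpu pmax]]] := bounded_optimum theta0_itv alpha_gt0 c_gt0 T0 I_range I_mono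
  mphi phi0 phiE iphi.
have [w adm] := control_admissible iphi cpu.
have [mp mu_ bp bu] := cpu.
have Jpu : Jfun theta0 alpha c I (fun t => asin (p t)) u =
    (payoff theta0 alpha c T I p u)%:E.
  rewrite -(total_payoff_control T0 mphi phi0 phiE iphi cpu).
  apply: Jfun_total_payoff => //; first by move=> t _; exact: asin_bounds.
  by move=> t _; rewrite asinK// itv1.
(* Removing all leaves from the optimal stem gives payoff 0, so competitors with a negative payoff
   are beaten at once and only the others need truncation. *)
have pay_ge0 : 0 <= payoff theta0 alpha c T I p u.
  have c0 : control theta0 phi p (cst 0).
    by split=> // t; rewrite lexx phi0.
  apply: le_trans (pmax _ _ c0); apply: Rintegral_ge0 => t _.
  rewrite /rate gain0 mulr0 sub0r /zstate /Rintegral integral0_eq//.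
  by rewrite powR0 ?gt_eqF// mulr0 oppr0.
exists (fun t => asin (p t)), u; split; first exact: adm.
move=> th' u' adm'; rewrite Jpu.
have [p' [v' [p'E v'E w']]] := admissible_wide adm'.
have [_ bth' _ _] := adm'.
rewrite (Jfun_total_payoff bth' p'E v'E w').
have [J0|J0] := leP 0%E (total_payoff theta0 alpha c I p' v'); last first.
  by apply: (le_trans (ltW J0)); rewrite lee_fin.
have [wt le_t] := truncation_improves theta0_itv alpha_itv c_gt0 I_range I_mono
  w' J0 mphi phi0 phi_exp.
apply: (le_trans le_t).
have ct : control theta0 phi p' (truncate v' phi).
  have [mp' mv' bp' v'_ge0 _] := w'; have [_ mt _ t_ge0 _] := wt.
  by split=> // t; rewrite t_ge0/= /truncate ge_min lexx orbT.
by rewrite (total_payoff_control T0 mphi phi0 phiE iphi ct) lee_fin; exact: pmax.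
Qed.

End optimal_stem.

Theorem theorem5p1 (R : realType) (theta0 alpha c : R) (I : R -> R)
  (htheta0 : 0 < theta0 < pi / 2) (halpha : 0 < alpha < 1) (hc : 0 < c)
  (hIrange : forall x, 0 <= x -> 0 <= I x <= 1)
  (hImono : forall x y, 0 <= x -> x <= y -> I x <= I y) :
  exists th u : R -> R, optimal theta0 alpha c I th u.
Proof. exact: optimal_exists. Qed.
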